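(* Let $K$ be a field, $X$ a nonempty set of arbitrary cardinality (finite or infinite), and $\Lambda=K\langle X\rangle$ the free associative algebra on $X$. Let $\gamma,\lambda\in\Lambda$ be comonic polynomials of positive degree, with associated finite-dimensional left $\Lambda$-modules $V_\gamma,V_\lambda$ with respect to the actions $\star_\gamma,\star_\lambda$. Let $\mathbb{L}(X)$ be the corresponding Leavitt algebra, and let $M_\lambda=\mathbb{L}(X)/\mathbb{L}(X)\lambda$, $M_\gamma=\mathbb{L}(X)/\mathbb{L}(X)\gamma$. (1) $\lambda$ is irreducible if and only if $M_\lambda$ and $V_\lambda$ are simple modules over $\mathbb{L}(X)$ and $\Lambda$, respectively. (2) If $\lambda=\pi_1\cdots\pi_m$ is a factorization of $\lambda$ into a product of irreducible polynomials, then $m$ is the length of both the $\mathbb{L}(X)$-module $M_\lambda$ and the $\Lambda$-module $V_\lambda$; hence $m$ is an invariant of $\lambda$. (3) $V_\lambda\cong V_\gamma$ (as $\Lambda$-modules) $\Longleftrightarrow$ $\Lambda/\Lambda\gamma\cong\Lambda/\Lambda\lambda$ (as $\Lambda$-modules) $\Longleftrightarrow$ $M_\gamma\cong M_\lambda$ (as $\mathbb{L}(X)$-modules); that is, $\gamma$ and $\lambda$ are similar over $\Lambda$ if and only if they are similar over $\mathbb{L}(X)$.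
   Context: $\mathbb{L}(X)$ is the unital $K$-algebra generated by $\{x,x^*: x\in X\}$ subject to $y^*x=1$ if $x=y$ and $y^*x=0$ if $x\ne y$ ($x,y\in X$), and, when $X$ is finite, additionally $\sum_{x\in X}xx^*=1$. The subalgebra generated by $X$ is the free algebra $\Lambda$. Every $\alpha\in\Lambda$ is written uniquely as $\alpha=k_\alpha+\sum_{x\in X} x\alpha_{x}$ (finite sum) with $k_\alpha\in K$, $\alpha_x\in\Lambda$ (right cofactors). For a monomial $b=y_1\cdots y_l$, $l\ge1$, $y_j\in X$, the iterated cofactor is $\alpha_b=(\cdots(\alpha_{y_1})_{y_2}\cdots)_{y_l}$. $\alpha$ is comonic if $k_\alpha=1$. For comonic $\lambda$, $\Lambda$ is a left $\Lambda$-module via $x\star_\lambda\alpha=-k_\alpha\lambda_x+\alpha_x$ ($x\in X$). $V_\lambda$ is the $K$-span of all cofactors $\lambda_b$ with $b$ a monomial of length $\ge1$; it is a finite-dimensional submodule for $\star_\lambda$. A nonzero, non-invertible element of a ring is irreducible if it is not a product of two nonzero non-invertible elements. Elements $a,b$ of a ring $A$ are similar over $A$ if $A/Aa\cong A/Ab$ as left $A$-modules. *)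

(* Defs.v *)
From HB Require Import structures.
From mathcomp Require Import all_boot all_algebra.
From mathcomp Require Import boolp finmap.
From mathcomp Require Import monalg.

Set Implicit Arguments.
Unset Strict Implicit.
Unset Printing Implicit Defensive.

Import GRing.Theory.
Local Open Scope ring_scope.
Local Open Scope quotient_scope.

Local Notation "1" := (@mone _) : monom_scope.
Local Notation "x * y" := (mmul x y) : monom_scope.

Section RingElements.
Variable A : pzRingType.

Definition invertible (a : A) : Prop := exists b, b * a = 1 /\ a * b = 1.

Definition irreducible (a : A) : Prop :=
  [/\ a != 0, ~ invertible a
    & ~ exists b c, [/\ b != 0 /\ ~ invertible b, c != 0 /\ ~ invertible c
                      & a = b * c]].

End RingElements.

Section Modules.
Variable R : pzRingType.

Definition isomorphic (V W : lmodType R) : Prop :=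
  exists f : {linear V -> W}, bijective f.

(* Under the classical axioms of boolp, {pred V} ranges over all subsets of V. *)
Definition simple_module (V : lmodType R) : Prop :=
  (exists v : V, v != 0) /\
  forall N : {pred V}, submod_closed N -> N =i pred1 0 \/ N =i predT.

(* For submodules N and P: N is contained in P and P / N is simple. *)
Definition maximal_in (V : lmodType R) (N P : {pred V}) : Prop :=
  [/\ {subset N <= P}, exists2 v, v \in P & v \notin N
    & forall Q : {pred V}, submod_closed Q ->
        {subset N <= Q} -> {subset Q <= P} -> Q =i N \/ Q =i P].

(* V has a composition series with m factors; by the Jordan-Hoelder theorem *)
(* there is at most one such m.                                             *)
Definition has_length (V : lmodType R) (m : nat) : Prop :=
  exists N : nat -> {pred V},
    [/\ forall i, (i <= m)%N -> submod_closed (N i),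
        N 0%N =i pred1 0, N m =i predT
      & forall i, (i < m)%N -> maximal_in (N i) (N i.+1)].

Section QuotientModule.
Variables (V : lmodType R) (N : {pred V}) (hN : submod_closed N).

Definition submod_pred (_ : submod_closed N) : {pred V} := N.
Local Notation S := (submod_pred hN).
HB.instance Definition _ := GRing.isSubmodClosed.Build R V S hN.

Definition quotmod : Type := Quotient.quot S.
HB.instance Definition _ := GRing.Zmodule.on quotmod.

Definition to_quotmod (v : V) : quotmod := \pi_(Quotient.quot S) v.

Lemma to_quotmodP u v : to_quotmod u = to_quotmod v <-> u - v \in N.
Proof.
by split=> [/eqP|h]; [|apply/eqP]; rewrite -Quotient.idealrBE.
Qed.

Lemma to_quotmodK (q : quotmod) : to_quotmod (repr (q : Quotient.quot S)) = q.
Proof. exact: reprK. Qed.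

Fact to_quotmodB : zmod_morphism to_quotmod.
Proof. by move=> u v; exact: (raddfB \pi_(Quotient.quot S)). Qed.
HB.instance Definition _ :=
  GRing.isZmodMorphism.Build V quotmod to_quotmod to_quotmodB.

Definition quotmod_scale (a : R) (q : quotmod) : quotmod :=
  to_quotmod (a *: repr (q : Quotient.quot S)).

Lemma quotmod_scaleE a v : quotmod_scale a (to_quotmod v) = to_quotmod (a *: v).
Proof.
apply/to_quotmodP; rewrite -scalerBr.
have [N0 NL] := hN; rewrite -[_ *: _]addr0; apply: NL => //.
by apply/to_quotmodP; rewrite to_quotmodK.
Qed.

Fact quotmod_scaleA a b (q : quotmod) :
  quotmod_scale a (quotmod_scale b q) = quotmod_scale (a * b) q.
Proof. by rewrite -(to_quotmodK q) !quotmod_scaleE scalerA. Qed.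

Fact quotmod_scale1 : left_id 1 quotmod_scale.
Proof. by move=> q; rewrite -(to_quotmodK q) quotmod_scaleE scale1r. Qed.

Fact quotmod_scaleDr : right_distributive quotmod_scale +%R.
Proof.
move=> a p q; rewrite -(to_quotmodK p) -(to_quotmodK q).
by rewrite -raddfD !quotmod_scaleE scalerDr raddfD.
Qed.

Fact quotmod_scaleDl (q : quotmod) : {morph quotmod_scale^~ q : a b / a + b}.
Proof.
move=> a b; rewrite -(to_quotmodK q) !quotmod_scaleE scalerDl.
by rewrite raddfD.
Qed.

HB.instance Definition _ := GRing.Zmodule_isLmodule.Build R quotmod
  quotmod_scaleA quotmod_scale1 quotmod_scaleDr quotmod_scaleDl.

Fact to_quotmodZ : scalable to_quotmod.
Proof. by move=> a v; exact: esym (quotmod_scaleE a v). Qed.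
HB.instance Definition _ :=
  GRing.isScalable.Build R V quotmod *:%R to_quotmod to_quotmodZ.

End QuotientModule.

Section CyclicModule.
Variable a : R.

Definition lideal : {pred R^o} := fun x => `[< exists b : R, x = b * a >].

Fact lideal_closed : submod_closed lideal.
Proof.
split=> [|c u v /asboolP[b ->] /asboolP[d ->]]; apply/asboolP.
  by exists 0; rewrite mul0r.
by exists (c * b + d); rewrite mulrDl -mulrA.
Qed.

Definition cyclic_module : lmodType R := quotmod lideal_closed.

End CyclicModule.

Definition similar_elements (a b : R) : Prop :=
  isomorphic (cyclic_module a) (cyclic_module b).

End Modules.

Section QuotientRing.
Variables (A : pzRingType) (S : A -> Prop).

Inductive in_ideal : A -> Prop :=
| in_ideal_gen a of S a : in_ideal a
| in_ideal0 : in_ideal 0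
| in_idealB a b of in_ideal a & in_ideal b : in_ideal (a - b)
| in_idealMl a b of in_ideal b : in_ideal (a * b)
| in_idealMr a b of in_ideal a : in_ideal (a * b).

Definition ideal_gen : {pred A} := fun a => `[< in_ideal a >].

Fact ideal_gen_closed : zmod_closed ideal_gen.
Proof.
split=> [|a b /asboolP aI /asboolP bI]; apply/asboolP; first exact: in_ideal0.
exact: in_idealB.
Qed.

HB.instance Definition _ := GRing.isZmodClosed.Build A ideal_gen ideal_gen_closed.

Definition quotring : Type := Quotient.quot ideal_gen.
HB.instance Definition _ := GRing.Zmodule.on quotring.

Definition to_quotring (a : A) : quotring := \pi_(Quotient.quot ideal_gen) a.

Lemma to_quotringP a b : to_quotring a = to_quotring b <-> in_ideal (a - b).
Proof.
split=> [/eqP|h]; first by rewrite -Quotient.idealrBE => /asboolP.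
by apply/eqP; rewrite -Quotient.idealrBE; apply/asboolP.
Qed.

Definition quotring_mul (u v : quotring) : quotring :=
  to_quotring (repr (u : Quotient.quot ideal_gen) * repr (v : Quotient.quot ideal_gen)).

Lemma to_quotringK (u : quotring) :
  to_quotring (repr (u : Quotient.quot ideal_gen)) = u.
Proof. exact: reprK. Qed.

Lemma quotring_mulE a b :
  quotring_mul (to_quotring a) (to_quotring b) = to_quotring (a * b).
Proof.
apply/to_quotringP; set a' := repr _; set b' := repr _.
have -> : a' * b' - a * b = a' * (b' - b) - (a - a') * b.
  by rewrite mulrBr mulrBl opprB addrA subrK.
apply: in_idealB; [apply: in_idealMl | apply: in_idealMr].
  exact/to_quotringP/to_quotringK.
by apply/to_quotringP; rewrite to_quotringK.
Qed.

Fact to_quotringB : zmod_morphism to_quotring.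
Proof. by move=> a b; exact: (raddfB \pi_(Quotient.quot ideal_gen)). Qed.
HB.instance Definition _ :=
  GRing.isZmodMorphism.Build A quotring to_quotring to_quotringB.

Fact quotring_mulA : associative quotring_mul.
Proof.
move=> u v w; rewrite -(to_quotringK u) -(to_quotringK v) -(to_quotringK w).
by rewrite !quotring_mulE mulrA.
Qed.

Fact quotring_mul1l : left_id (to_quotring 1) quotring_mul.
Proof. by move=> u; rewrite -(to_quotringK u) quotring_mulE mul1r. Qed.

Fact quotring_mul1r : right_id (to_quotring 1) quotring_mul.
Proof. by move=> u; rewrite -(to_quotringK u) quotring_mulE mulr1. Qed.

Fact quotring_mulDl : left_distributive quotring_mul +%R.
Proof.
move=> u v w; rewrite -(to_quotringK u) -(to_quotringK v) -(to_quotringK w).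
by rewrite -raddfD !quotring_mulE mulrDl raddfD.
Qed.

Fact quotring_mulDr : right_distributive quotring_mul +%R.
Proof.
move=> u v w; rewrite -(to_quotringK u) -(to_quotringK v) -(to_quotringK w).
by rewrite -raddfD !quotring_mulE mulrDr raddfD.
Qed.

HB.instance Definition _ := GRing.Zmodule_isPzRing.Build quotring
  quotring_mulA quotring_mul1l quotring_mul1r quotring_mulDl quotring_mulDr.

Fact to_quotringM : monoid_morphism to_quotring.
Proof. by split=> // a b; rewrite -quotring_mulE. Qed.
HB.instance Definition _ :=
  GRing.isMonoidMorphism.Build A quotring to_quotring to_quotringM.

End QuotientRing.

Notation free_alg K X := {malg K[{fmonom X}]}.

Section FreeAlgebra.
Variables (K : fieldType) (X : choiceType).
Local Notation Lam := (free_alg K X).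
Implicit Types (a b : Lam) (x : X) (m : {fmonom X}).

Definition fvar x : Lam := << fmu x >>.

Definition const_coef a : K := a@_1%M.

(* mmeasure is 0 at 0 and one more than the degree elsewhere. *)
Definition degree a : nat := (mmeasure (@fdeg X) a).-1.

Definition comonic a : Prop := const_coef a = 1.

(* The right cofactor a_x; see cofactor_decomp and cofactor_unique. *)
Definition cofactor x a : Lam :=
  [malg m in [fset FMonom (behead (fmonom_val w)) | w in msupp a]%fset =>
     a@_(fmu x * m)%M].

Definition iter_cofactor (w : seq X) a : Lam :=
  foldl (fun c x => cofactor x c) a w.

Lemma cofactorE x a m : (cofactor x a)@_m = a@_(fmu x * m)%M.
Proof.
rewrite mcoeffE; case: ifPn => // mN; apply/esym/mcoeff_outdom.
apply: contra mN => xm; apply/imfsetP; exists (fmu x * m)%M => //.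
by apply/eqP; rewrite fmP fmM fmU.
Qed.

Fact cofactor_is_zmod_morphism x : zmod_morphism (cofactor x).
Proof. by move=> a b; apply/malgP => m; rewrite !(mcoeffB, cofactorE). Qed.
HB.instance Definition _ x :=
  GRing.isZmodMorphism.Build Lam Lam (cofactor x) (cofactor_is_zmod_morphism x).

Fact cofactor_is_scalable x : scalable (cofactor x).
Proof. by move=> c a; apply/malgP => m; rewrite !(mcoeffZ, cofactorE). Qed.
HB.instance Definition _ x :=
  GRing.isScalable.Build K Lam Lam *:%R (cofactor x) (cofactor_is_scalable x).

Lemma fmonom_case m :
  m = 1%M \/ exists x m', m = (fmu x * m')%M.
Proof.
case: m => [[|x s]]; [left | right].
  by apply/eqP; rewrite fmP fm1.
by exists x, (FMonom s); apply/eqP; rewrite fmP fmM fmU.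
Qed.

Lemma mcoeff_fvarM x a m :
  (fvar x * a)@_m = \sum_(k <- msupp a) a@_k *+ (fmu x * k == m)%M.
Proof.
rewrite malgM_def fgmulUg raddf_sum /=; apply: eq_bigr => k _.
by rewrite mcoeffU mul1r.
Qed.

Lemma mcoeff_fvarM1 x a : (fvar x * a)@_1%M = 0.
Proof.
rewrite mcoeff_fvarM big1 // => k _.
by rewrite fmM_eq1 fm1_eq1.
Qed.

Lemma mcoeff_fvarMM x y a m :
  (fvar x * a)@_(fmu y * m)%M = a@_m *+ (x == y).
Proof.
rewrite mcoeff_fvarM; under eq_bigr => k _.
  have -> : (fmu x * k == fmu y * m)%M = (x == y) && (k == m).
    by rewrite fmP !fmM !fmU eqseq_cons fmP.
  over.
case: eqVneq => [_|_]; last by rewrite big1.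
rewrite mulr1n [in RHS](monalgE a) raddf_sum /=.
by apply: eq_bigr => k _; rewrite mcoeffU.
Qed.

Lemma cofactor_decomp a :
  exists s : seq X, uniq s /\
    a = (const_coef a)%:MP + \sum_(x <- s) fvar x * cofactor x a.
Proof.
pose s := undup (flatten [seq fmonom_val w | w <- enum_fset (msupp a)]).
exists s; split; first exact: undup_uniq.
apply/malgP => m; rewrite mcoeffD mcoeffC raddf_sum /=.
case: (fmonom_case m) => [->|[y [m' ->]]].
  rewrite eqxx big1 ?addr0 // => x _; exact: mcoeff_fvarM1.
rewrite fmM_eq1 fm1_eq1 add0r.
under eq_bigr => x _ do rewrite mcoeff_fvarMM cofactorE.
have [ys|yNs] := boolP (y \in s).
  rewrite (bigD1_seq y) //= ?undup_uniq // eqxx big1 ?addr0 // => x.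
  by move=> /negPf ->.
rewrite mcoeff_outdom; last first.
  apply: contra yNs => my; rewrite mem_undup; apply/flattenP.
  exists (fmonom_val (fmu y * m')%M); first exact: (map_f (@fmonom_val X)).
  by rewrite fmM fmU inE eqxx.
rewrite big_seq big1 // => x xs; case: eqVneq => // xy.
by rewrite -xy xs in yNs.
Qed.

Lemma cofactor_unique a (k : K) (s : seq X) (f : X -> Lam) :
    uniq s -> a = k%:MP + \sum_(x <- s) fvar x * f x ->
  const_coef a = k /\ forall x, cofactor x a = if x \in s then f x else 0.
Proof.
move=> s_uniq ->; split=> [|y].
  rewrite /const_coef mcoeffD mcoeffC eqxx raddf_sum /= big1 ?addr0 // => x _.
  exact: mcoeff_fvarM1.
apply/malgP => m; rewrite cofactorE mcoeffD mcoeffC fmM_eq1 fm1_eq1 add0r.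
rewrite raddf_sum /=; under eq_bigr => x _ do rewrite mcoeff_fvarMM.
case: ifPn => [ys|yNs].
  rewrite (bigD1_seq y) //= eqxx big1 ?addr0 // => x.
  by move=> /negPf ->.
rewrite mcoeff0 big_seq big1 // => x xs; case: eqVneq => // xy.
by rewrite -xy xs in yNs.
Qed.

End FreeAlgebra.

(* The module over the free algebra on X obtained by letting every x in X act *)
(* on the K-space V by f x; the monomial y_1 ... y_l then acts by             *)
(* v |-> f y_1 (... (f y_l v)).                                               *)
Section FreeModule.
Variables (K : fieldType) (X : choiceType) (V : lmodType K).
Variable f : X -> {linear V -> V}.
Local Notation Lam := (free_alg K X).
Implicit Types (a b : Lam) (x : X) (m : {fmonom X}).

Definition free_module (_ : X -> {linear V -> V}) : Type := V.
Local Notation W := (free_module f).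
HB.instance Definition _ := GRing.Zmodule.on W.

Definition monom_act m (v : V) : V := foldr (fun x => f x) v (fmonom_val m).

Definition free_act a (v : W) : W :=
  \sum_(m <- msupp a) a@_m *: monom_act m v.

Fact monom_act_is_linear m : linear (monom_act m).
Proof.
case: m => s c u v; rewrite /monom_act /=.
by elim: s => //= x s ->; rewrite linearP.
Qed.
HB.instance Definition _ m :=
  GRing.isLinear.Build K V V *:%R (monom_act m) (monom_act_is_linear m).

Lemma monom_act1 v : monom_act 1%M v = v.
Proof. by rewrite /monom_act fm1. Qed.

Lemma monom_actM m1 m2 v :
  monom_act (m1 * m2)%M v = monom_act m1 (monom_act m2 v).
Proof. by rewrite /monom_act fmM foldr_cat. Qed.

Lemma free_actEw (d : {fset {fmonom X}}) a v : (msupp a `<=` d)%fset ->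
  free_act a v = \sum_(m <- d) a@_m *: monom_act m v.
Proof.
move=> le; rewrite [LHS](big_fset_incl _ le) // => m _ /mcoeff_outdom ->.
by rewrite scale0r.
Qed.

Fact free_actDl (v : W) : {morph free_act^~ v : a b / a + b}.
Proof.
move=> a b; pose d := (msupp a `|` msupp b)%fset.
rewrite (free_actEw (d := d)) ?msuppD_le //.
rewrite (free_actEw (d := d) (a := a)) ?fsubsetUl //.
rewrite (free_actEw (d := d) (a := b)) ?fsubsetUr //.
by rewrite -big_split; apply: eq_bigr => m _; rewrite mcoeffD scalerDl.
Qed.

Lemma free_actU c m v : free_act << c *g m >> v = c *: monom_act m v.
Proof. by rewrite (free_actEw (d := [fset m]%fset)) ?msuppU_le // big_seq_fset1 mcoeffUU. Qed.

Fact free_act1 : left_id 1 free_act.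
Proof. by move=> v; rewrite free_actU monom_act1 scale1r. Qed.

Fact free_actDr : right_distributive free_act +%R.
Proof.
move=> a u v; rewrite /free_act -big_split; apply: eq_bigr => m _.
by rewrite raddfD scalerDr.
Qed.

Lemma free_act0 v : free_act 0 v = 0.
Proof. by rewrite /free_act msupp0 big_seq_fset0. Qed.

Lemma free_act_suml I (r : seq I) (F : I -> Lam) v :
  free_act (\sum_(i <- r) F i) v = \sum_(i <- r) free_act (F i) v.
Proof. exact: (big_morph (free_act^~ v) (free_actDl v) (free_act0 v)). Qed.

Fact free_actA a b (v : W) : free_act a (free_act b v) = free_act (a * b) v.
Proof.
rewrite malgME free_act_suml [LHS]/free_act; apply: eq_bigr => m _.
rewrite free_act_suml raddf_sum scaler_sumr /=; apply: eq_bigr => n _.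
by rewrite free_actU linearZZ monom_actM scalerA.
Qed.

HB.instance Definition _ := GRing.Zmodule_isLmodule.Build Lam W
  free_actA free_act1 free_actDr free_actDl.

Lemma fvar_scaleE x (v : W) : fvar K x *: v = f x v :> W.
Proof. by rewrite /GRing.scale /= free_actU scale1r /monom_act fmU. Qed.

End FreeModule.

Section StarModule.
Variables (K : fieldType) (X : choiceType) (lam : free_alg K X).
Local Notation Lam := (free_alg K X).

(* star x a is x star_lam a. *)
Definition star (x : X) (a : Lam) : Lam :=
  - (const_coef a *: cofactor x lam) + cofactor x a.

Fact star_is_linear x : linear (star x).
Proof.
move=> c a b; rewrite /star /const_coef mcoeffD mcoeffZ linearP.
by rewrite scalerDl scalerDr scalerN -scalerA opprD addrACA.
Qed.
HB.instance Definition _ x :=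
  GRing.isLinear.Build K Lam Lam *:%R (star x) (star_is_linear x).

Definition star_module : lmodType Lam := free_module (fun x => star x).

Lemma star_moduleE x (a : star_module) :
  fvar K x *: a = - (const_coef a *: cofactor x lam) + cofactor x (a : Lam)
    :> Lam.
Proof. exact: fvar_scaleE. Qed.

(* The K-span of the iterated cofactors lam_b, b a monomial of length >= 1, *)
(* as a subset of star_module.                                              *)
Definition cofactor_span : {pred star_module} := fun v =>
  `[< exists r : seq (K * seq X),
        all (fun p => p.2 != [::]) r /\
        v = \sum_(p <- r) p.1 *: iter_cofactor p.2 lam :> Lam >].

Let in_span (v : Lam) : Prop := v \in cofactor_span.

Let in_span0 : in_span 0.
Proof. by apply/asboolP; exists [::]; rewrite big_nil. Qed.

Let in_spanD u v : in_span u -> in_span v -> in_span (u + v).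
Proof.
move=> /asboolP[r [r0 ->]] /asboolP[t [t0 ->]]; apply/asboolP.
by exists (r ++ t); rewrite all_cat r0 t0 big_cat.
Qed.

Let in_spanZ (c : K) v : in_span v -> in_span (c *: v).
Proof.
move=> /asboolP[r [r0 ->]]; apply/asboolP.
exists [seq (c * p.1, p.2) | p <- r]; split; first by rewrite all_map.
by rewrite scaler_sumr big_map; apply: eq_bigr => p _; rewrite scalerA.
Qed.

Let in_span_iter b : b != [::] -> in_span (iter_cofactor b lam).
Proof.
move=> b0; apply/asboolP; exists [:: (1, b)].
by rewrite /= b0 big_seq1 scale1r.
Qed.

Let in_span_cofactor x v : in_span v -> in_span (cofactor x v).
Proof.
move=> /asboolP[r [/allP r0 ->]]; rewrite raddf_sum big_seq /=.
elim/big_ind: _ => [||p /r0 p0]; [exact: in_span0 | exact: in_spanD |].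
rewrite linearZZ /=; apply: in_spanZ.
suff -> : cofactor x (iter_cofactor p.2 lam) = iter_cofactor (rcons p.2 x) lam.
  by apply: in_span_iter; case: (p.2).
by rewrite /iter_cofactor foldl_rcons.
Qed.

Let in_span_star x v : in_span v -> in_span (star x v).
Proof.
move=> vS; apply: in_spanD; last exact: in_span_cofactor.
rewrite -scaleNr; apply: in_spanZ; exact: (in_span_iter (b := [:: x])).
Qed.

Fact cofactor_span_closed : submod_closed cofactor_span.
Proof.
split=> [|a u v uS vS]; first exact: in_span0.
apply: in_spanD vS; rewrite /GRing.scale /= /free_act.
elim/big_ind: _ => [||m _]; [exact: in_span0 | exact: in_spanD |].
apply: in_spanZ; rewrite /monom_act.
by elim: (fmonom_val m) => //= x s IHs; apply: in_span_star.
Qed.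
HB.instance Definition _ :=
  GRing.isSubmodClosed.Build Lam star_module cofactor_span cofactor_span_closed.

(* The module V_lam. *)
Record cofactor_module := CofactorModule {
  cofactor_module_val :> star_module;
  _ : cofactor_module_val \in cofactor_span
}.
HB.instance Definition _ := [isSub for cofactor_module_val].
HB.instance Definition _ := [Choice of cofactor_module by <:].
HB.instance Definition _ := [SubChoice_isSubLmodule of cofactor_module by <:].

End StarModule.

Section Leavitt.
Variables (K : fieldType) (X : choiceType).

(* inl x stands for the generator x and inr x for the generator x^*. *)
Local Notation F := (free_alg K (X + X)%type).
Local Notation var x := (fvar K (inl x)).
Local Notation svar x := (fvar K (inr x)).

(* leavitt_sum has instances only when X is finite, s being then an *)
(* enumeration of X.                                                *)
Inductive leavitt_rel : F -> Prop :=
| leavitt_same x : leavitt_rel (svar x * var x - 1)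
| leavitt_diff x y of x != y : leavitt_rel (svar y * var x)
| leavitt_sum s of uniq s & (forall x, x \in s) :
    leavitt_rel (\sum_(x <- s) var x * svar x - 1).

Definition leavitt : pzRingType := quotring leavitt_rel.

Definition fmonom_inl (m : {fmonom X}) : F :=
  << FMonom [seq inl x | x <- fmonom_val m] >>.

Fact fmonom_inl_mmorphism : mmorphism fmonom_inl.
Proof.
split=> [m n|]; last first.
  by congr << _ >>; apply/eqP; rewrite fmP !fm1.
rewrite malgM_def fgmulUU mulr1; congr << _ >>; apply/eqP.
by rewrite fmP !fmM /= map_cat.
Qed.
HB.instance Definition _ := isMultiplicative.Build {fmonom X} F fmonom_inl
  fmonom_inl_mmorphism.

(* The ring morphism from the free algebra on X that maps x to x and a *)
(* constant c%:MP to the scalar c of the K-algebra leavitt.            *)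
Definition leavitt_of (a : free_alg K X) : leavitt :=
  to_quotring leavitt_rel (mmap (@malgC {fmonom (X + X)%type} K) fmonom_inl a).

Fact leavitt_of_is_zmod_morphism : zmod_morphism leavitt_of.
Proof. by move=> a b; rewrite /leavitt_of !raddfB. Qed.
HB.instance Definition _ := GRing.isZmodMorphism.Build _ _ leavitt_of
  leavitt_of_is_zmod_morphism.

Fact leavitt_of_is_monoid_morphism : monoid_morphism leavitt_of.
Proof.
have comm c (g : F) : GRing.comm (c%:MP : F) g.
  rewrite /GRing.comm mul_malgC malgM_def fgmulgU malgZ_def /fgscale.
  by apply: eq_bigr => m _; rewrite mulm1 mulrC.
have [mapM map1] := @commr_mmap_is_multiplicative {fmonom X} K F _ fmonom_inl
  (fun g m m' => comm g@_m (fmonom_inl m')).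
split=> [|a b]; rewrite /leavitt_of; first by rewrite map1 rmorph1.
by rewrite mapM rmorphM.
Qed.
HB.instance Definition _ := GRing.isMonoidMorphism.Build _ _ leavitt_of
  leavitt_of_is_monoid_morphism.

Lemma leavitt_of_var x :
  leavitt_of (fvar K x) = to_quotring leavitt_rel (var x).
Proof.
rewrite /leavitt_of mmapU; congr (to_quotring _ _).
rewrite -[RHS]mul1r; congr (_ * << _ >>).
by rewrite [fmu (inl x)]fmuE fmU.
Qed.

End Leavitt.

(* Main.v *)
(* Let lam be comonic. On M = L / L lam the relation lam = 0 forces x^* to act  *)
(* on the image of Lam as the star action, so M is Lam / Lam lam with x^*      *)
(* acting by star, and its submodules correspond to the left ideals of Lam     *)
(* that contain lam and are stable under star; each of them is generated by    *)
(* its comonic element of least degree, hence is Lam b for a right factor b    *)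
(* of lam. Applying long words in the x^* moves any element of M into V_lam,   *)
(* and V_lam is the least star-stable subspace with this property. Therefore   *)
(* N |-> N :&: V_lam is an isomorphism from the submodule lattice of M to that *)
(* of V_lam, and an isomorphism of M restricts to V_lam; conversely, an        *)
(* isomorphism phi of V_gam onto V_lam extends to the cyclic modules by        *)
(* 1 |-> - \sum_x x phi (gam_x).                                               *)

From HB Require Import structures.
Require Import Defs.
From mathcomp Require Import all_boot all_algebra.
From mathcomp Require Import boolp monalg.

Set Implicit Arguments.
Unset Strict Implicit.
Unset Printing Implicit Defensive.

Import GRing.Theory.
Local Open Scope ring_scope.

(* Both Defs and matrix define cofactor. *)
Local Notation cofactor := Defs.cofactor.

(** Everything passes through the left ideals of Lam that contain lam and are stable under the star
    action ([saturated]). Since x^* sends y u to u or 0, kills lam, and u = k_u lam + sum_x x star_x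
    u ([star_decomp]), the quotient Lam / Lam lam satisfies the Leavitt relations; it is M
    ([leavitt_of_lideal], [lcyc_surj]), so the submodules of M are these ideals modulo Lam lam. On
    the side of V_lam, an ideal goes to its intersection with V_lam, and a submodule S to the
    elements that all long star words bring into S ([absorb]); [absorb_in_span] and
    [saturated_absorb_in_span] make these maps inverse to each other.

    Division by a comonic element of least degree shows that each saturated ideal is Lam b with lam
    = a b ([saturated_factor]). Both submodule lattices thus describe the right factors of lam, and
    (1) and (2) are proved once from [saturated_lattice]: the suffix products of a factorization
    into irreducibles form a composition series, whose length is unique by [has_length_unique].

    For (3), an isomorphism of cyclic modules is encoded by the image s of 1, and
    [similarity_leavitt] moves s between Lam and the Leavitt algebra. If gam s lies in Lam lam, then
    u -> u s intertwines the two star actions modulo Lam lam ([star_mulr_diff]), which gives V_gam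
    -> V_lam ([witness_span_isomorphic]); [span_isomorphic_witness] builds s from an isomorphism of
    V_gam onto V_lam. *)

(** * Coefficients, degree and cancellation in the free algebra *)

Section FreeAlgebraTheory.
Variables (K : fieldType) (X : choiceType).
Local Notation Lam := (free_alg K X).
Implicit Types (a b u v : Lam) (c : K) (x y : X) (q w : seq X).

Lemma const_coefB : {morph @const_coef K X : a b / a - b}.
Proof. exact: mcoeffB. Qed.

Lemma const_coefZ c a : const_coef (c *: a) = c * const_coef a.
Proof. exact: mcoeffZ. Qed.

Lemma const_coefC c : const_coef (c%:MP : Lam) = c.
Proof. by rewrite /const_coef mcoeffC eqxx. Qed.

Lemma const_coef0 : const_coef (0 : Lam) = 0.
Proof. exact: mcoeff0. Qed.

Lemma const_coef1 : const_coef (1 : Lam) = 1.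
Proof. exact: const_coefC. Qed.

Lemma const_coefM a b : const_coef (a * b) = const_coef a * const_coef b.
Proof. by case: (@mcoeff1g_is_multiplicative {fmonom X} K) => h _; exact: h. Qed.

Lemma cofactorC x c : cofactor x (c%:MP : Lam) = 0.
Proof.
apply/malgP => m; rewrite cofactorE mcoeffC mcoeff0 fmM_eq1 fm1_eq1.
by rewrite mulr0n.
Qed.

Lemma cofactor_fvarM x y a : cofactor x (fvar K y * a) = a *+ (y == x).
Proof.
by apply/malgP => m; rewrite cofactorE mcoeff_fvarMM mcoeffMn.
Qed.

Lemma const_coef_fvarM y a : const_coef (fvar K y * a) = 0.
Proof. exact: mcoeff_fvarM1. Qed.

Lemma malgZ_mulr c a b : a * (c *: b) = c *: (a * b).
Proof.
rewrite -!mul_malgC mulrA [RHS]mulrA; congr (_ * _).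
rewrite mul_malgC malgM_def fgmulgU malgZ_def /fgscale.
by apply: eq_bigr => m _; rewrite Monoid.mulm1 mulrC.
Qed.

Lemma cofactorM x a b :
  cofactor x (a * b) = cofactor x a * b + const_coef a *: cofactor x b.
Proof.
have [s [s_uniq {1 2}->]] := cofactor_decomp a.
rewrite mulrDl !raddfD /= mul_malgC linearZZ cofactorC add0r addrC /=.
congr (_ + _); rewrite mulr_suml !raddf_sum mulr_suml; apply: eq_bigr => y _.
by rewrite -mulrA /= !cofactor_fvarM mulrnAl.
Qed.

Definition coef w a : K := a@_(FMonom w).

Lemma coef_nil a : coef [::] a = const_coef a.
Proof. by congr mcoeff; apply/eqP; rewrite fmP fm1. Qed.

Lemma coef_cons x w a : coef (x :: w) a = coef w (cofactor x a).
Proof.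
by rewrite /coef cofactorE; congr mcoeff; apply/eqP; rewrite fmP fmM fmU.
Qed.

Lemma coef_iter w a : coef w a = const_coef (iter_cofactor w a).
Proof. by elim: w a => [|x w IHw] a; rewrite ?coef_nil // coef_cons IHw. Qed.

Lemma coefP a b : (forall w, coef w a = coef w b) -> a = b.
Proof. by move=> eq_ab; apply/malgP => m; rewrite -(fmK m); exact: eq_ab. Qed.

Lemma coef0 w : coef w 0 = 0. Proof. exact: mcoeff0. Qed.
Lemma coefD w a b : coef w (a + b) = coef w a + coef w b.
Proof. exact: mcoeffD. Qed.
Lemma coefZ w c a : coef w (c *: a) = c * coef w a.
Proof. exact: mcoeffZ. Qed.

(** [degree] does not tell 0 from the nonzero constants; here [deg_lt 0] holds only for 0. *)
Definition deg_lt (n : nat) a := forall w, (n <= size w)%N -> coef w a = 0.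

Lemma deg_lt_exists a : exists n, deg_lt n a.
Proof.
exists (mmeasure (@fdeg X) a) => w le_w; apply: mcoeff_outdom.
by apply: mmeasure_mnm_ge; apply: leq_trans le_w _.
Qed.

Lemma deg_lt_min a :
  exists2 n, deg_lt n a & forall m, deg_lt m a -> (n <= m)%N.
Proof.
pose P n := `[< deg_lt n a >].
have exP : exists n, P n by have [n an] := deg_lt_exists a; exists n; apply/asboolP.
by case: (ex_minnP exP) => n /asboolP an minn; exists n => // m /asboolP /minn.
Qed.

Lemma deg_lt0 a : deg_lt 0 a -> a = 0.
Proof. by move=> a0; apply: coefP => w; rewrite coef0 a0. Qed.

Lemma deg_ltW m n a : (m <= n)%N -> deg_lt m a -> deg_lt n a.
Proof. by move=> le_mn am w le_w; apply: am; apply: leq_trans le_w. Qed.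

Lemma deg_lt_cofactor n x a : deg_lt n.+1 a -> deg_lt n (cofactor x a).
Proof. by move=> an w le_w; rewrite -coef_cons an. Qed.

Lemma deg_lt_zero n : deg_lt n (0 : Lam).
Proof. by move=> w _; rewrite coef0. Qed.

Lemma deg_ltD n a b : deg_lt n a -> deg_lt n b -> deg_lt n (a + b).
Proof. by move=> an bn w le_w; rewrite coefD an ?bn ?addr0. Qed.

Lemma deg_ltZ n c a : deg_lt n a -> deg_lt n (c *: a).
Proof. by move=> an w le_w; rewrite coefZ an ?mulr0. Qed.

Lemma deg_ltB n a b : deg_lt n a -> deg_lt n b -> deg_lt n (a - b).
Proof. by move=> an bn; rewrite -scaleN1r; apply: deg_ltD => //; apply: deg_ltZ. Qed.

(** Taking cofactors lowers the degree, so this serves as induction on the degree. *)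
Lemma cofactor_ind (P : Lam -> Prop) :
  P 0 -> (forall a, (forall x, P (cofactor x a)) -> P a) -> forall a, P a.
Proof.
move=> P0 PS a; have [n] := deg_lt_exists a.
elim: n a => [|n IHn] a an; first by rewrite (deg_lt0 an).
by apply: PS => x; apply: IHn; apply: deg_lt_cofactor.
Qed.

Lemma cofactors_eq0 a : (forall x, cofactor x a = 0) -> a = (const_coef a)%:MP.
Proof.
move=> a0; have [s [_ {1}->]] := cofactor_decomp a.
by rewrite big1 ?addr0 // => x _; rewrite a0 mulr0.
Qed.

(** The constant term of u b forces k_u = 0; then the x-cofactor of u b is u_x b, so the cofactors
    of u satisfy the same equation. *)
Lemma mulr_const_coef_inj b u :
  const_coef b != 0 -> u * b = 0 -> u = 0.
Proof.
move=> kb; elim/cofactor_ind: u => // u IHu ub0.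
have ku0 : const_coef u = 0.
  have /eqP := congr1 (@const_coef K X) ub0.
  by rewrite const_coefM const_coef0 mulf_eq0 (negPf kb) orbF => /eqP.
rewrite (cofactors_eq0 (a := u)) ?ku0 ?malgC0E // => x; apply: IHu.
have := congr1 (cofactor x) ub0.
by rewrite cofactorM ku0 scale0r addr0 raddf0.
Qed.

Lemma linv_invertible b u : const_coef b != 0 -> u * b = 1 -> invertible b.
Proof.
move=> kb ub; exists u; split=> //.
apply/eqP; rewrite -subr_eq0; apply/eqP; apply: (mulr_const_coef_inj kb).
by rewrite mulrBl -mulrA ub mulr1 mul1r subrr.
Qed.

(* The top coefficient of u times that of b would survive. *)
Lemma mulr_deg_eq0 n d b u :
    size d = n -> coef d b != 0 -> deg_lt n.+1 b -> deg_lt n (u * b) -> u = 0.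
Proof.
move=> sd bd bn; elim/cofactor_ind: u => // u IHu ubn.
have u0 x : cofactor x u = 0.
  apply: IHu; rewrite (_ : _ * b = cofactor x (u * b) - const_coef u *: cofactor x b).
    apply: deg_ltB; first by apply: deg_lt_cofactor; apply: deg_ltW ubn.
    exact/deg_ltZ/deg_lt_cofactor.
  by rewrite cofactorM addrK.
have uE := cofactors_eq0 u0; have := ubn d; rewrite {1}uE mul_malgC coefZ sd.
move/(_ (leqnn _))/eqP; rewrite mulf_eq0 (negPf bd) orbF => /eqP ku.
by rewrite uE ku malgC0E.
Qed.

Lemma deg_top a : a != 0 ->
  exists d, coef d a != 0 /\ deg_lt (size d).+1 a.
Proof.
move=> a0; have [[|n] an minn] := deg_lt_min a; first by rewrite (deg_lt0 an) eqxx in a0.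
apply: contrapT => no_d; suff /minn : deg_lt n a by rewrite ltnn.
move=> w; rewrite leq_eqVlt => /orP[/eqP sw|]; last exact: an.
apply/eqP/negPn/negP => wa; apply: no_d; exists w; by rewrite -sw.
Qed.

End FreeAlgebraTheory.

(** * The star action, saturated left ideals and absorption *)

Lemma opp_add_cancel (V : zmodType) (p q r : V) : - (p + q) + (r + q) = r - p.
Proof. by rewrite opprD addrACA addNr addr0 addrC. Qed.

Lemma mul_linvK (R : pzRingType) (a b c d : R) :
  a * b = 1 -> c * a * (b * d) = c * d.
Proof. by move=> ab; rewrite -mulrA (mulrA a) ab mul1r. Qed.

Section StarTheory.
Variables (K : fieldType) (X : choiceType).
Local Notation Lam := (free_alg K X).
Implicit Types (a b u v lam : Lam) (c : K) (x y : X) (q w : seq X).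
Implicit Types (S J : Lam -> Prop).

Definition left_mult b u : Prop := exists a, u = a * b.

(** The last letter of [q] acts first, whence the inductions on words from the right. *)
Definition star_word lam q u : Lam := foldr (star lam) u q.

Definition star_stable lam S : Prop :=
  [/\ S 0, forall c u v, S u -> S v -> S (c *: u + v)
    & forall x u, S u -> S (star lam x u)].

(* The left ideals containing lam that are stable under the star action are *)
(* the preimages of the submodules of the Leavitt module of lam.            *)
Definition saturated lam J : Prop :=
  [/\ J lam, J 0, forall a u v, J u -> J v -> J (a * u + v)
    & forall x u, J u -> J (star lam x u)].

(** Recovers a saturated ideal from its trace on V_lam. *)
Definition absorb lam S u : Prop :=
  exists n, forall q, (n <= size q)%N -> S (star_word lam q u).

Definition in_span lam u : Prop :=
  (u : star_module lam) \in @cofactor_span K X lam.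

Lemma star_wordP lam q c u v :
  star_word lam q (c *: u + v) = c *: star_word lam q u + star_word lam q v.
Proof. by elim: q => //= x q ->; rewrite linearP. Qed.

Lemma star_word0 lam q : star_word lam q 0 = 0.
Proof. by elim: q => //= x q ->; rewrite raddf0. Qed.

Lemma star_wordD lam q u v :
  star_word lam q (u + v) = star_word lam q u + star_word lam q v.
Proof. by elim: q => //= x q ->; rewrite raddfD. Qed.

Lemma star_wordB lam q u v :
  star_word lam q (u - v) = star_word lam q u - star_word lam q v.
Proof. by elim: q => //= x q ->; rewrite raddfB. Qed.

Lemma star_wordZ lam q c u : star_word lam q (c *: u) = c *: star_word lam q u.
Proof. by elim: q => [//|x q IHq]; rewrite /= IHq; exact: linearZZ. Qed.

Lemma star_word_cons lam q x u :
  star_word lam (x :: q) u = star lam x (star_word lam q u).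
Proof. by []. Qed.

Lemma star_word_rcons lam q x u :
  star_word lam (rcons q x) u = star_word lam q (star lam x u).
Proof. by rewrite /star_word foldr_rcons. Qed.

Lemma star_stable_word lam S q u :
  star_stable lam S -> S u -> S (star_word lam q u).
Proof. by case=> _ _ Sx Su; elim: q => //= x q; apply: Sx. Qed.

Lemma star_stableD lam S u v : star_stable lam S -> S u -> S v -> S (u + v).
Proof. by case=> _ SP _ Su Sv; rewrite -[u]scale1r; apply: SP. Qed.

Lemma star_stableZ lam S c u : star_stable lam S -> S u -> S (c *: u).
Proof. by case=> S0 SP _ Su; rewrite -[_ *: _]addr0; apply: SP. Qed.

Lemma star_stableB lam S u v : star_stable lam S -> S u -> S v -> S (u - v).
Proof.
by case=> _ SP _ Su Sv; rewrite addrC -scaleN1r; apply: SP.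
Qed.

Lemma star_stable_sum lam S I (r : seq I) (F : I -> Lam) :
  star_stable lam S -> (forall i, S (F i)) -> S (\sum_(i <- r) F i).
Proof.
move=> Sst SF; elim/big_ind: _ => // [|u v]; first by case: Sst.
exact: (star_stableD Sst).
Qed.

Lemma saturated_stable lam J : saturated lam J -> star_stable lam J.
Proof.
by case=> _ J0 JP Jx; split=> // c u v Ju Jv; rewrite -mul_malgC; apply: JP.
Qed.

Lemma saturatedM lam J a u : saturated lam J -> J u -> J (a * u).
Proof. by case=> _ J0 JP _ Ju; rewrite -[_ * _]addr0; apply: JP. Qed.

Lemma star_stable_span lam : star_stable lam (in_span lam).
Proof.
have h := cofactor_span_closed lam.
have Sa (a : Lam) (u : star_module lam) : in_span lam u -> in_span lam (a *: u).
  move=> Su; rewrite /in_span -[_ *: _]addr0; apply: (h.2) => //; exact: (h.1).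
have SD u v : in_span lam u -> in_span lam v -> in_span lam (u + v).
  by move=> Su Sv; have := h.2 1 _ _ Su Sv; rewrite scale1r.
split; first exact: (h.1).
  move=> c u v Su Sv; apply: SD => //.
  suff <- : (c%:MP : Lam) *: (u : star_module lam) = c *: u :> Lam by exact: Sa.
  by rewrite [LHS]/GRing.scale /= free_actU monom_act1.
move=> x u /(Sa (fvar K x)); congr in_span; exact: fvar_scaleE.
Qed.

Lemma in_span_iter lam w : w != [::] -> in_span lam (iter_cofactor w lam).
Proof.
move=> w0; apply/asboolP; exists [:: (1, w)].
by rewrite /= w0 big_seq1 scale1r.
Qed.

Lemma in_span_min lam S :
    S 0 -> (forall c u v, S u -> S v -> S (c *: u + v)) ->
    (forall w, w != [::] -> S (iter_cofactor w lam)) ->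
  forall u, in_span lam u -> S u.
Proof.
move=> S0 SP Sw u /asboolP[r [r0 ->]].
elim: r r0 => [|p r IHr] /=; first by rewrite big_nil.
by case/andP=> p0 r0; rewrite big_cons; apply: SP; [apply: Sw | apply: IHr].
Qed.

Lemma in_span_cofactor1 lam x : in_span lam (cofactor x lam).
Proof. exact: (in_span_iter lam (w := [:: x])). Qed.

Lemma cofactorE_star lam x u :
  cofactor x u = star lam x u + const_coef u *: cofactor x lam.
Proof. by rewrite /star addrAC addNr add0r. Qed.

Lemma in_span_cofactor lam x u : in_span lam u -> in_span lam (cofactor x u).
Proof.
have Vst := star_stable_span lam.
move=> Vu; rewrite (cofactorE_star lam); apply: (star_stableD Vst).
  by case: Vst => _ _; apply.
exact/(star_stableZ _ Vst)/in_span_cofactor1.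
Qed.

Lemma star_fvarM lam x y u : star lam x (fvar K y * u) = u *+ (y == x).
Proof. by rewrite /star const_coef_fvarM scale0r oppr0 add0r cofactor_fvarM. Qed.

Lemma star_id lam x : comonic lam -> star lam x lam = 0.
Proof. by rewrite /star => ->; rewrite scale1r addNr. Qed.

(* u - k lam has constant term 0, and its cofactors are the star x u. *)
Lemma star_decomp lam u : comonic lam ->
  exists s : seq X,
    u = const_coef u *: lam + \sum_(x <- s) fvar K x * star lam x u.
Proof.
move=> lam1; pose w := u - const_coef u *: lam.
have w0 : const_coef w = 0 by rewrite const_coefB const_coefZ lam1 mulr1 subrr.
have [s [_ wE]] := cofactor_decomp w; exists s.
have sE x : star lam x u = cofactor x w.
  by rewrite /w raddfB /= linearZZ addrC.
under eq_bigr => x _ do rewrite sE.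
move: wE; rewrite w0 malgC0E add0r => <-.
by rewrite addrC subrK.
Qed.

(** By [star_decomp], u is determined modulo lam by finitely many star x u; this plays the part of
    sum_x x x^* = 1, also for infinite X. *)
Lemma saturated_star lam J u : comonic lam -> saturated lam J ->
  (forall x, J (star lam x u)) -> J u.
Proof.
move=> lam1 Jsat Ju; have Jst := saturated_stable Jsat.
have [s ->] := star_decomp u lam1; apply: (star_stableD Jst).
  by apply: (star_stableZ _ Jst); case: Jsat.
by apply: (star_stable_sum _ Jst) => x; apply: (saturatedM _ Jsat).
Qed.

Lemma saturated_absorb lam J u : comonic lam -> saturated lam J ->
  absorb lam J u -> J u.
Proof.
move=> lam1 Jsat [n]; elim: n u => [|n IHn] u Ju; first exact: (Ju [::]).
apply: (saturated_star lam1 Jsat) => x; apply: IHn => q le_q.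
by rewrite -star_word_rcons; apply: Ju; rewrite size_rcons.
Qed.

Lemma absorb_star_stable lam S : star_stable lam S ->
  forall c u v, absorb lam S u -> absorb lam S v -> absorb lam S (c *: u + v).
Proof.
case=> _ SP _ c u v [n nu] [m mv]; exists (maxn n m) => q.
rewrite geq_max => /andP[le_n le_m]; rewrite star_wordP.
by apply: SP; [apply: nu | apply: mv].
Qed.

(** One more letter is enough: acting first, it strips x or gives 0. *)
Lemma absorb_fvarM lam S x u : star_stable lam S ->
  absorb lam S u -> absorb lam S (fvar K x * u).
Proof.
move=> Sst [n nu]; exists n.+1; case/lastP => // q y; rewrite size_rcons ltnS.
move=> le_q; rewrite star_word_rcons star_fvarM; case: eqP => _; first exact: nu.
by rewrite mulr0n star_word0; case: Sst.
Qed.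

Lemma absorb_saturated lam S : comonic lam -> star_stable lam S ->
  saturated lam (absorb lam S).
Proof.
move=> lam1 Sst; have AP := absorb_star_stable Sst; have [S0 _ _] := Sst.
have A0 : absorb lam S 0 by exists 0 => q _; rewrite star_word0.
have AD u v : absorb lam S u -> absorb lam S v -> absorb lam S (u + v).
  by move=> Au Av; rewrite -[u]scale1r; apply: AP.
split=> //.
- exists 1%N; case/lastP => // q x _.
  by rewrite star_word_rcons star_id // star_word0.
- move=> a u v Au Av; apply: (AD) => //.
  elim/cofactor_ind: a => [|a IHa]; first by rewrite mul0r.
  have [s [_ ->]] := cofactor_decomp a.
  rewrite mulrDl mul_malgC; apply: (AP) => //.
  rewrite mulr_suml; elim/big_ind: _ => [||x _]; [exact: A0 | exact: AD |].
  by rewrite -mulrA; apply: absorb_fvarM => //; apply: IHa.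
- move=> x u [n nu]; exists n => q le_q; rewrite -star_word_rcons; apply: nu.
  by rewrite size_rcons leqW.
Qed.

(** Each letter replaces u by a cofactor of lower degree plus a multiple of some lam_x, which
    already lies in the stable space V_lam. *)
Lemma absorb_span lam u : absorb lam (in_span lam) u.
Proof.
have Vst := star_stable_span lam.
have [n un] := deg_lt_exists u; exists n => q.
elim: n u un q => [|n IHn] u un q.
  by move=> _; rewrite (deg_lt0 un) star_word0; case: Vst.
case/lastP: q => // q x; rewrite size_rcons ltnS => le_q.
rewrite star_word_rcons /star -scaleNr star_wordP.
case: (Vst) => _ VP _; apply: VP; last by apply: IHn => //; apply: deg_lt_cofactor.
exact/(star_stable_word _ Vst)/in_span_cofactor1.
Qed.

Lemma left_multP b : forall a u v,
  left_mult b u -> left_mult b v -> left_mult b (a * u + v).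
Proof. by move=> a _ _ [c ->] [d ->]; exists (a * c + d); rewrite mulrDl mulrA. Qed.

Lemma left_mult_refl b : left_mult b b.
Proof. by exists 1; rewrite mul1r. Qed.

Lemma left_mult0 b : left_mult b 0.
Proof. by exists 0; rewrite mul0r. Qed.

Lemma starM lam x u b : star lam x (u * b) =
  - ((const_coef u * const_coef b) *: cofactor x lam) +
    (cofactor x u * b + const_coef u *: cofactor x b).
Proof. by rewrite /star const_coefM cofactorM. Qed.

(** The terms in b_x cancel because k_a k_b = 1, and a multiple of b is left. *)
Lemma star_mulr lam a b x u : lam = a * b -> comonic lam ->
  left_mult b (star lam x (u * b)).
Proof.
move=> lamE lam1; have kab : const_coef b * const_coef a = 1.
  by rewrite mulrC -const_coefM -lamE.
exists (cofactor x u - (const_coef u * const_coef b) *: cofactor x a).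
rewrite starM lamE cofactorM mulrBl -scalerAl.
move: (_ * b) (_ * b) (cofactor x b) => p r t.
by rewrite scalerDr scalerA -(mulrA _ (const_coef b)) kab mulr1 opp_add_cancel.
Qed.

Lemma left_mult_saturated lam b : comonic lam -> left_mult b lam ->
  saturated lam (left_mult b).
Proof.
move=> lam1 [a lamE]; split; first by exists a.
- exact: left_mult0.
- exact: left_multP.
by move=> x _ [u ->]; apply: star_mulr lamE lam1.
Qed.

(** Right multiplication by b carries the star action of a to that of a b, so questions about
    multiples of b descend to the left factor a. *)
Lemma star_mulr_comonic a b x u : comonic a -> comonic b ->
  star (a * b) x (u * b) = star a x u * b.
Proof.
move=> a1 b1; rewrite starM b1 mulr1 cofactorM a1 scale1r.
rewrite /star mulrDl mulNr -scalerAl.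
move: (_ * b) (_ * b) (cofactor x b) => p r t.
by rewrite scalerDr opp_add_cancel addrC.
Qed.

Lemma star_word_mulr a b q u : comonic a -> comonic b ->
  star_word (a * b) q (u * b) = star_word a q u * b.
Proof.
move=> a1 b1; elim: q => [|x q IHq]; first by [].
rewrite !star_word_cons IHq.
exact: star_mulr_comonic.
Qed.

Lemma comonic_neq0 a : comonic a -> a != 0.
Proof.
move=> a1; apply/eqP => a0; move: a1; rewrite /comonic a0 const_coef0.
by move/esym/eqP; rewrite oner_eq0.
Qed.

(** Elements of V_lam have degree below that of lam; nonzero multiples of lam do not. *)
Lemma in_span_left_mult lam u : comonic lam ->
  in_span lam u -> left_mult lam u -> u = 0.
Proof.
move=> lam1 Vu [a uE].
have [d [dlam lam_deg]] := deg_top (comonic_neq0 lam1).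
suff ud : deg_lt (size d) u.
  by rewrite uE (mulr_deg_eq0 _ dlam lam_deg (u := a)) ?mul0r // -uE.
apply: in_span_min Vu => [|c v w vd wd|w].
- exact: deg_lt_zero.
- by apply: deg_ltD => //; apply: deg_ltZ.
case: w => // x w _ /=; have := deg_lt_cofactor x lam_deg.
elim: w (cofactor x lam) => //= y w IHw v vd; apply: IHw.
exact/deg_lt_cofactor/(deg_ltW (leqnSn _)).
Qed.

(* A monomial d of maximal degree in a gives star_word q (cofactor x a) as a *)
(* multiple of star_word (rcons q x) applied to the cofactor of a at d.      *)
Lemma in_span_absorb1 a S : comonic a -> star_stable a S ->
  absorb a S 1 -> forall u, in_span a u -> S u.
Proof.
move=> a1 Sst [n0 Sn0]; have [S0 SP _] := Sst.
pose P n := forall q, (n <= size q)%N -> S (star_word a q 1).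
have star1 x : star a x 1 = - cofactor x a.
  by rewrite /star const_coef1 scale1r -(mpolyC1E _ K) cofactorC addr0.
have Pspan n : P n.+1 -> forall w q, w != [::] -> (n <= size q)%N ->
    S (star_word a q (iter_cofactor w a)).
  move=> Pn; elim/last_ind => // w x IHw q _ le_q.
  have Sx : S (star_word a q (cofactor x a)).
    rewrite -[cofactor x a]opprK -star1 -scaleN1r star_wordZ.
    apply: (star_stableZ _ Sst); rewrite -star_word_rcons; apply: Pn.
    by rewrite size_rcons.
  rewrite /iter_cofactor foldl_rcons -/(iter_cofactor w a).
  rewrite (cofactorE_star a) star_wordD star_wordZ.
  apply: (star_stableD Sst); last exact: (star_stableZ _ Sst).
  case: w IHw => [_|y w IHw].
    by rewrite /= star_id // star_word0.
  by rewrite -star_word_rcons; apply: IHw => //; rewrite size_rcons leqW.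
(* The cofactor of [a] at a top monomial is a nonzero constant, so its own cofactors vanish;
   combined with [Pspan] this lowers the bound on the word length by one, down to 1. *)
have P1 : P 1%N.
  have : P n0.+1 by move=> q /ltnW; apply: Sn0.
  elim: n0 {Sn0} => // n IHn Pn; apply: IHn.
  have [d [da a_deg]] := deg_top (comonic_neq0 a1).
  have dx x : cofactor x (iter_cofactor d a) = 0.
    have : deg_lt 1 (iter_cofactor d a).
      elim: d a a_deg {da Pn Pspan star1 Sst P a1} => //= y d IHd a.
      by move=> a_deg; apply: IHd; apply: deg_lt_cofactor.
    by move/(deg_lt_cofactor x)/deg_lt0.
  case/lastP => // q x; rewrite size_rcons ltnS => le_q.
  rewrite star_word_rcons star1 -scaleN1r star_wordZ.
  apply: (star_stableZ _ Sst).
  case: d da {a_deg} dx => [|y d] da dx.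
    by rewrite (dx x : cofactor x a = 0) star_word0.
  have := cofactorE_star a x (iter_cofactor (y :: d) a).
  rewrite dx => /(congr1 (star_word a q)).
  rewrite star_word0 star_wordD star_wordZ -star_word_rcons.
  move/eqP; rewrite eq_sym addrC addr_eq0 => /eqP kS.
  rewrite coef_iter in da.
  rewrite -[star_word a q _]scale1r -(mulVf da) -scalerA kS -scaleN1r.
  do 2!apply: (star_stableZ _ Sst).
  by apply: Pspan Pn _ _ _ _ => //; rewrite size_rcons.
apply: in_span_min => // w w0; exact: (Pspan 0%N P1 w [::]).
Qed.

(** By the product rule, cofactors keep the shape v b + w, as V_a and V_b are closed under
    cofactors. *)
Lemma in_span_mul a b u : comonic a -> comonic b -> in_span (a * b) u ->
  exists v w : Lam, [/\ in_span a v, in_span b w & u = v * b + w].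
Proof.
move=> a1 b1; have [Va0 VaP _] := star_stable_span a.
have [Vb0 VbP _] := star_stable_span b.
pose S u' := exists v w : Lam,
  [/\ in_span a v, in_span b w & u' = v * b + w].
apply: (in_span_min (S := S)) => [|c _ _ [v [w [Vv Vw ->]]] [v' [w' [Vv' Vw' ->]]]|].
- by exists 0, 0; split => //; rewrite mul0r addr0.
- exists (c *: v + v'), (c *: w + w'); split; [exact: VaP | exact: VbP |].
  by rewrite scalerDr mulrDl scalerAl addrACA.
elim/last_ind => // w x IHw _.
rewrite /iter_cofactor foldl_rcons -/(iter_cofactor w (a * b)).
case: w IHw => [_|y w] /=.
  exists (cofactor x a), (cofactor x b); split; try exact: in_span_cofactor1.
  by rewrite cofactorM a1 scale1r.
case=> // v [w' [Vv Vw' ->]].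
exists (cofactor x v), (const_coef v *: cofactor x b + cofactor x w').
split; first exact: in_span_cofactor.
  by apply: VbP; [apply: in_span_cofactor1 | apply: in_span_cofactor].
by rewrite raddfD /= cofactorM addrA.
Qed.

(* A comonic element of J of minimal degree generates J. *)
Lemma saturated_principal lam J : comonic lam -> saturated lam J ->
  exists b, comonic b /\ forall u, J u <-> left_mult b u.
Proof.
move=> lam1 Jsat; have Jst := saturated_stable Jsat.
pose P n := `[< exists b, [/\ comonic b, J b & deg_lt n b] >].
have exP : exists n, P n.
  have [n lamn] := deg_lt_exists lam; exists n; apply/asboolP.
  by exists lam; split => //; case: Jsat.
case: (ex_minnP exP) => n /asboolP[b [b1 Jb bn]] minn.
(* Both sides are the x-cofactor of u - k_u b, so J is stable under the star action of b too. *)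
have Jx x u : J u -> J (star b x u).
  move=> Ju; suff -> : star b x u = star lam x (u - const_coef u *: b).
    case: (Jst) => _ _; apply; apply: (star_stableB Jst) => //.
    exact: (star_stableZ _ Jst).
  rewrite /star const_coefB const_coefZ b1 mulr1 subrr scale0r oppr0 add0r.
  by rewrite raddfB /= [X in _ = _ - X]linearZZ addrC.
have n0 : (0 < n)%N.
  rewrite lt0n; apply/eqP => n0; move: bn; rewrite n0 => /deg_lt0/eqP.
  by rewrite (negPf (comonic_neq0 b1)).
(* [n.-1] is the degree of b. A nonzero constant term of u could be scaled to 1, against minimality;
   otherwise the cofactors of u are its star images and lie in J. *)
have small u : deg_lt n.-1 u -> J u -> u = 0.
  elim/cofactor_ind: u => // u IHu un Ju.
  have ku : const_coef u = 0.
    apply/eqP/negPn/negP => ku; suff /minn : P n.-1 by rewrite leqNgt prednK ?leqnn.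
    apply/asboolP; exists ((const_coef u)^-1 *: u); split.
    - by rewrite /comonic const_coefZ mulVf.
    - exact: (star_stableZ _ Jst).
    - exact: deg_ltZ.
  rewrite (cofactors_eq0 (a := u)) ?ku ?malgC0E // => x; apply: IHu.
    by apply: deg_lt_cofactor; apply: deg_ltW un.
  by have := Jx x _ Ju; rewrite /star ku scale0r oppr0 add0r.
exists b; split=> // u; split=> [Ju|[a ->]]; last exact: (saturatedM _ Jsat).
(* Division by b: [star_decomp] for b splits off k_u b and leaves the star b x u, of smaller
   degree. *)
have [m um] := deg_lt_exists u.
have {um} : deg_lt (n.-1 + m) u by apply: deg_ltW um; apply: leq_addl.
elim: m u Ju => [|m IHm] u Ju um.
  rewrite addn0 in um; rewrite (small u um Ju).
  exact: left_mult0.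
have [s ->] := star_decomp u b1.
rewrite -mul_malgC; apply: left_multP; first exact: left_mult_refl.
elim/big_ind: _ => [|v w|x _].
- exact: left_mult0.
- by move=> v_b w_b; rewrite -[v]mul1r; apply: left_multP.
rewrite -[_ * _]addr0; apply: left_multP; last exact: left_mult0.
apply: IHm; first exact: Jx.
rewrite /star -scaleNr; apply: deg_ltD.
  apply: deg_ltZ; apply: deg_lt_cofactor; apply: deg_ltW bn.
  by rewrite -addSn prednK ?leq_addr.
by apply: deg_lt_cofactor; rewrite -addnS.
Qed.

Lemma saturated_factor lam J : comonic lam -> saturated lam J ->
  exists a b, [/\ comonic a, comonic b, lam = a * b
    & forall u, J u <-> left_mult b u].
Proof.
move=> lam1 Jsat; have [b [b1 JE]] := saturated_principal lam1 Jsat.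
have [a lamE] : left_mult b lam by apply/JE; case: Jsat.
exists a, b; split=> //.
by move: lam1; rewrite /comonic lamE const_coefM b1 mulr1.
Qed.

(** Let the absorbed ideal be Lam b, with lam = a b. By [in_span_mul], u = v b + w with w in V_b; as
    w also lies in Lam b, it is 0. The v' with v' b in S form a star-stable space for a that absorbs
    1, so by [in_span_absorb1] it contains V_a. *)
Lemma absorb_in_span lam S u : comonic lam -> star_stable lam S ->
    (forall v, S v -> in_span lam v) ->
  in_span lam u -> absorb lam S u -> S u.
Proof.
move=> lam1 Sst SV Vu Au; have [S0 SP Sx] := Sst.
have [a [b [a1 b1 lamE JE]]] := saturated_factor lam1 (absorb_saturated lam1 Sst).
move: Vu; rewrite lamE => /(in_span_mul a1 b1)[v [w [Vv Vw uE]]].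
have w0 : w = 0.
  apply: (in_span_left_mult b1 Vw); have /JE [t ut] := Au.
  by exists (t - v); rewrite mulrBl -ut uE addrC addKr.
rewrite uE w0 addr0; pose T v' := S (v' * b).
rewrite -/(T v).
apply: (in_span_absorb1 a1 (S := T) _ _ Vv).
  split; first by rewrite /T mul0r.
    move=> c u1 u2 T1 T2; rewrite /T.
    suff -> : (c *: u1 + u2) * b = c *: (u1 * b) + u2 * b by exact: SP T1 T2.
    by rewrite mulrDl -scalerAl.
  move=> x u1 T1; rewrite /T.
  suff -> : star a x u1 * b = star lam x (u1 * b) by exact: Sx T1.
  by rewrite lamE; exact/esym/star_mulr_comonic.
have [n bn] : absorb lam S b by exact/JE/left_mult_refl.
exists n => q le_q; rewrite /T.
suff -> : star_word a q 1 * b = star_word lam q b by exact: bn.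
have := star_word_mulr q 1 a1 b1.
by rewrite mul1r lamE => /esym.
Qed.

(** Long words bring J into V_lam, and a saturated J contains whatever they bring into J. *)
Lemma saturated_absorb_in_span lam J u : comonic lam -> saturated lam J ->
  absorb lam (fun v => J v /\ in_span lam v) u <-> J u.
Proof.
move=> lam1 Jsat; split=> [[n nu]|Ju].
  by apply: (saturated_absorb lam1 Jsat); exists n => q /nu[].
have [n nu] := absorb_span lam u; exists n => q le_q; split; last exact: nu.
exact: star_stable_word (saturated_stable Jsat) Ju.
Qed.

End StarTheory.

(** * Uniqueness of the length of a composition series *)

Section CompositionSeries.
Variables (R : pzRingType) (V : lmodType R).
Implicit Types (N P : nat -> {pred V}) (A B : {pred V}).

Lemma submod_closed_pred1 : submod_closed (pred1 (0 : V)).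
Proof.
split=> [|a u v]; rewrite ?inE // => /eqP-> /eqP->.
by rewrite scaler0 addr0.
Qed.

Lemma submod_closed_predT : submod_closed (predT : {pred V}).
Proof. by []. Qed.

Lemma submodD A u v : submod_closed A -> u \in A -> v \in A -> u + v \in A.
Proof. by case=> _ AP uA vA; rewrite -[u]scale1r; apply: AP. Qed.

Lemma submodB A u v : submod_closed A -> u \in A -> v \in A -> u - v \in A.
Proof. by case=> _ AP uA vA; rewrite addrC -scaleN1r; apply: AP. Qed.

Lemma submodZ A a u : submod_closed A -> u \in A -> a *: u \in A.
Proof. by case=> A0 AP uA; rewrite -[_ *: _]addr0; apply: AP. Qed.

Lemma submod_closedI A B :
  submod_closed A -> submod_closed B -> submod_closed [predI A & B].
Proof.
case=> A0 AP [B0 BP]; split=> [|a u v]; rewrite !inE ?A0 ?B0 //.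
by case/andP=> uA uB /andP[vA vB]; apply/andP; split; [apply: AP | apply: BP].
Qed.

Definition submod_sum A B : {pred V} :=
  fun v => `[< exists a b, [/\ a \in A, b \in B & v = a + b] >].

Lemma submod_closed_sum A B :
  submod_closed A -> submod_closed B -> submod_closed (submod_sum A B).
Proof.
case=> A0 AP [B0 BP]; split=> [|c u v].
  by apply/asboolP; exists 0, 0; rewrite addr0.
case/asboolP=> [a [b [aA bB ->]]] /asboolP[a' [b' [aA' bB' ->]]].
apply/asboolP; exists (c *: a + a'), (c *: b + b').
by split; [exact: AP | exact: BP | rewrite scalerDr addrACA].
Qed.

(** Modular law: P + A = B by maximality, so v = p + a with a in both P' and A; if these all lay in
    P, so would v. *)
Lemma maximal_in_strictI A B (P P' : {pred V}) :
    submod_closed A -> submod_closed B -> submod_closed P -> submod_closed P' ->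
    maximal_in A B -> {subset P <= P'} -> {subset P' <= B} ->
    (exists2 v, v \in P & v \notin A) -> (exists2 v, v \in P' & v \notin P) ->
  exists2 v, v \in [predI P' & A] & v \notin P.
Proof.
move=> Acl Bcl Pcl Pcl' [AB _ max] PP' PB' [w wP wA] [v vP' vP].
apply: contrapT => no; move/negP: vP; apply.
have sub u : u \in P' -> u \in A -> u \in P.
  move=> uP' uA; apply/negPn/negP => uP; apply: no; exists u => //.
  by apply/andP; split.
pose S := submod_sum P A.
have AS : {subset A <= S}.
  by move=> a aA; apply/asboolP; exists 0, a; rewrite add0r; split=> //; case: Pcl.
have PS : {subset P <= S}.
  by move=> p pP; apply/asboolP; exists p, 0; rewrite addr0; split=> //; case: Acl.
have SB : {subset S <= B}.
  move=> _ /asboolP[p [a [pP aA ->]]]; apply: (submodD Bcl); last exact: AB.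
  exact/PB'/PP'.
have [SA|SBE] := max S (submod_closed_sum Pcl Acl) AS SB.
  by case/negP: wA; rewrite -SA; apply: PS.
have : v \in S by rewrite SBE; apply: PB'.
case/asboolP=> [p [a [pP aA vE]]]; rewrite vE; apply: (submodD Pcl) => //.
apply: sub => //; rewrite -[a](addKr p) -vE addrC.
exact/(submodB Pcl' vP')/PP'.
Qed.

Lemma series_sub N m i j : (forall i, (i < m)%N -> {subset N i <= N i.+1}) ->
  (i <= j <= m)%N -> {subset N i <= N j}.
Proof.
move=> Nsub /andP[]; elim: j => [|j IHj]; first by rewrite leqn0 => /eqP-> _ v.
rewrite leq_eqVlt => /orP[/eqP-> _ v //|le_ij] lt_jm v.
by move/(IHj le_ij (ltnW lt_jm)); apply: Nsub.
Qed.

(* Intersecting the chain P with N (m.-1) repeats at most one term, by *)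
(* modularity and the maximality of N (m.-1).                          *)
Lemma strict_chain_length m k N P :
    (forall i, (i <= m)%N -> submod_closed (N i)) ->
    (forall i, (i < m)%N -> maximal_in (N i) (N i.+1)) ->
    (forall i, (i <= k)%N -> submod_closed (P i)) ->
    (forall i, (i < k)%N -> {subset P i <= P i.+1}) ->
    (forall i, (i < k)%N -> exists2 v, v \in P i.+1 & v \notin P i) ->
    {subset N 0%N <= P 0%N} -> {subset P k <= N m} ->
  (k <= m)%N.
Proof.
elim: m k P => [|m IHm] k P Ncl Nmax Pcl Psub Plt NP PN.
  case: k Pcl Psub Plt PN => // k Pcl Psub Plt PN.
  have le1 : (1 <= k.+1 <= k.+1)%N by rewrite leqnn.
  have [v vP1 /negP[]] := Plt 0%N isT.
  exact/NP/PN/(series_sub Psub le1).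
have Ncl' i : (i <= m)%N -> submod_closed (N i) by move/leqW/Ncl.
have Nmax' i : (i < m)%N -> maximal_in (N i) (N i.+1) by move/ltnW/Nmax.
have [PNm|] := pselect {subset P k <= N m}.
  exact/leqW/(IHm k P).
move=> nPN; pose B i := `[< exists2 v, v \in P i & v \notin N m >].
have Bk : B k.
  apply/asboolP; apply: contrapT => no; apply: nPN => v vP.
  by apply/negPn/negP => vN; apply: no; exists v.
case: (ex_minnP (ex_intro B k Bk)) => i /asboolP[w wP wN] mini.
have le_ik := mini k Bk.
have small j : (j < i)%N -> {subset P j <= N m}.
  move=> lt_ji v vP; apply/negPn/negP => vN.
  have /mini : B j by apply/asboolP; exists v.
  by rewrite leqNgt lt_ji.
case: k le_ik Pcl Psub Plt PN {nPN Bk} => // k le_ik Pcl Psub Plt PN.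
have Nm_cl : submod_closed (N m) by apply: Ncl.
have Pcap j : (i <= j <= k)%N ->
    exists2 v, v \in [predI P j.+1 & N m] & v \notin P j.
  case/andP=> le_ij le_jk.
  apply: (maximal_in_strictI Nm_cl (Ncl _ (leqnn _)) (Pcl _ (leqW le_jk))
            (Pcl _ _) (Nmax _ (leqnn _)) (Psub _ _) _ _ (Plt _ _)) => //.
    have le_j : (j.+1 <= k.+1 <= k.+1)%N by rewrite ltnS le_jk leqnn.
    by move=> v /(series_sub Psub le_j)/PN.
  have le_i : (i <= j <= k.+1)%N by rewrite le_ij leqW.
  by exists w => //; apply: (series_sub Psub le_i) wP.
(* i is the first index where P leaves N m. The term P i with N m may repeat the one before it and
   is left out, hence the shift to [j.+1]. *)
rewrite ltnS; pose Q j := if (j < i)%N then P j else [predI P j.+1 & N m].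
apply: (IHm k Q) => // [j le_jk|j lt_jk|j lt_jk|v vN|v].
- rewrite /Q; case: ifP => _; first exact/Pcl/leqW.
  exact/submod_closedI/Nm_cl/Pcl.
- have lt_jk' := ltnW lt_jk; move=> v; rewrite /Q.
  case: (ltnP j i) => ji; last first.
    rewrite ltnNge (leqW ji) /= => /andP[vP vN]; apply/andP; split=> //.
    exact: Psub vP.
  case: ifP => ji' vP; first exact: Psub vP.
  apply/andP; split; last exact: small vP.
  exact: (Psub j.+1 lt_jk _ (Psub j lt_jk' _ vP)).
- rewrite /Q; have [ji|ji] := ltnP j.+1 i.
    by rewrite (ltnW ji); apply: Plt; apply: ltnW.
  have [v vPN vP] := Pcap j.+1 (introT andP (conj ji lt_jk)).
  exists v => //; case: ifP => _; last by rewrite inE (negPf vP).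
  by apply: contra vP; apply: Psub; apply: ltnW.
- rewrite /Q; case: ifP => _; first exact: NP.
  apply/andP; split; first exact: (Psub 0%N isT _ (NP v vN)).
  apply: (@series_sub N m 0%N m _ _ v vN); last by rewrite leqnn.
  by move=> j lt_jm; case: (Nmax' j lt_jm).
- by rewrite /Q; case: ifP => [ki /(small _ ki)|_ /andP[]].
Qed.

Lemma has_length_unique m k : has_length V m -> has_length V k -> m = k.
Proof.
suff le m1 m2 : has_length V m1 -> has_length V m2 -> (m1 <= m2)%N.
  by move=> hm hk; apply/eqP; rewrite eqn_leq !le.
case=> P [Pcl P0 PT Pmax] [N [Ncl N0 NT Nmax]].
apply: (strict_chain_length Ncl Nmax Pcl) => [i lt_i|i lt_i|v|v _].
- by case: (Pmax i lt_i).
- by case: (Pmax i lt_i).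
- by rewrite N0 P0.
- by rewrite NT.
Qed.

Lemma has_length1_simple : has_length V 1 -> simple_module V.
Proof.
case=> N [_ N0 N1 /(_ 0%N isT)[_ [v _ vN] max]]; split.
  by exists v; apply: contra vN => /eqP ->; rewrite N0 inE.
move=> A Acl; have [||AE|AE] := max A Acl.
- by move=> w; rewrite N0 inE => /eqP ->; case: Acl.
- by move=> w _; rewrite N1.
- by left => w; rewrite AE N0.
- by right => w; rewrite AE N1.
Qed.

End CompositionSeries.

(** * Irreducibility and length read off from the lattice of saturated ideals *)

Section SaturatedLattice.
Variables (K : fieldType) (X : choiceType).
Local Notation Lam := (free_alg K X).
Implicit Types (lam p b : Lam) (J : Lam -> Prop).

(** Mutually inverse monotone maps between submodules and saturated ideals, kept abstract so as to
    cover both M and V_lam. *)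
Definition saturated_lattice lam (R : pzRingType) (Q : lmodType R)
    (I : {pred Q} -> Lam -> Prop) (Sb : (Lam -> Prop) -> {pred Q}) : Prop :=
  [/\ forall N, submod_closed N -> saturated lam (I N) /\ Sb (I N) =i N,
      forall J, saturated lam J ->
        submod_closed (Sb J) /\ forall u, I (Sb J) u <-> J u,
      forall N N' : {pred Q}, {subset N <= N'} -> forall u, I N u -> I N' u
    & forall J J', (forall u, J u -> J' u) -> {subset Sb J <= Sb J'}].

Lemma irreducible_cancel p a b : irreducible p -> const_coef p != 0 ->
  p = a * b -> invertible a \/ invertible b.
Proof.
case=> _ _ irr kp pE; have := kp; rewrite pE const_coefM mulf_eq0 => /norP[ka kb].
have nz c : const_coef c != 0 -> c != 0 :> Lam.
  by apply: contraNneq => ->; rewrite const_coef0.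
have [ia|na] := pselect (invertible a); first by left.
have [ib|nb] := pselect (invertible b); first by right.
by case: irr; exists a, b; split=> //; split=> //; apply: nz.
Qed.

Section Lattice.
Variables (lam : Lam) (R : pzRingType) (Q : lmodType R).
Variables (I : {pred Q} -> Lam -> Prop) (Sb : (Lam -> Prop) -> {pred Q}).
Hypotheses (lam1 : comonic lam) (latQ : saturated_lattice lam I Sb).

Let satT : saturated lam (fun _ => True). Proof. by []. Qed.

Lemma lattice_predT : Sb (fun _ => True) =i predT.
Proof.
have [NI _ _ Smono] := latQ; move=> v.
have [_ IT] := NI _ (@submod_closed_predT _ Q).
by rewrite [RHS]isT; move: (isT : v \in predT); rewrite -IT; apply: Smono.
Qed.

Lemma lattice_pred1 : Sb (left_mult lam) =i pred1 0.
Proof.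
have [NI JS _ Smono] := latQ; move=> v; apply/idP/idP.
  have [Isat <-] := NI _ (@submod_closed_pred1 _ Q).
  by apply: Smono => _ [a ->]; apply: (saturatedM _ Isat); case: Isat.
have lam_lam := left_mult_refl lam.
move/eqP->.
by have [[S0 _] _] := JS _ (left_mult_saturated lam1 lam_lam).
Qed.

(** A submodule in between comes from some Lam d with d = t b and p b = s d. Cancelling b gives p =
    s t, so s or t is invertible. Strictness holds because b in Lam p b would make p invertible. *)
Lemma maximal_in_irreducible p b : irreducible p -> left_mult (p * b) lam ->
  maximal_in (Sb (left_mult (p * b))) (Sb (left_mult b)).
Proof.
have [NI JS Imono Smono] := latQ.
move=> irr [a lamE]; have : const_coef lam != 0 by rewrite lam1 oner_neq0.
rewrite lamE !const_coefM !mulf_eq0 !negb_or => /and3P[_ kp kb].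
have satb : saturated lam (left_mult b).
  by apply: left_mult_saturated => //; exists (a * p); rewrite lamE; apply: mulrA.
have satpb : saturated lam (left_mult (p * b)).
  by apply: left_mult_saturated => //; exists a.
have b_b := left_mult_refl b.
split=> [||N Ncl subN Nsub].
- by apply: Smono => _ [c ->]; exists (c * p); apply: mulrA.
- apply: contrapT => no.
  have sub : {subset Sb (left_mult b) <= Sb (left_mult (p * b))}.
    move=> v vb; apply/negPn/negP => vpb; apply: no; exists v => //.
  have [_ Ib] := JS _ satb; have [_ Ipb] := JS _ satpb.
  have [c bE] := (Ipb b).1 (Imono _ _ sub b ((Ib b).2 b_b)).
  have [_ /(_ (linv_invertible kp (u := c) _))[]] : [/\ p != 0, ~ invertible p & True].
    by case: irr.
  apply/eqP; rewrite -subr_eq0; apply/eqP; apply: (mulr_const_coef_inj kb).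
  by rewrite mulrBl mul1r -mulrA -bE subrr.
have [Isat NE] := NI _ Ncl.
have [d [_ IE]] := saturated_principal lam1 Isat.
have [_ Ib] := JS _ satb; have [_ Ipb] := JS _ satpb.
have [t dE] : left_mult b d.
  exact/Ib/(Imono _ _ Nsub)/IE/left_mult_refl.
have [s pbE] : left_mult d (p * b).
  exact/IE/(Imono _ _ subN)/Ipb/left_mult_refl.
have pE : p = s * t.
  apply/eqP; rewrite -subr_eq0; apply/eqP; apply: (mulr_const_coef_inj kb).
  by rewrite mulrBl -mulrA -dE -pbE subrr.
have [[s' [s's _]]|[t' [t't _]]] := irreducible_cancel irr kp pE; [left|right].
  move=> v; apply/idP/idP; last exact: subN.
  rewrite -NE; apply: Smono => u /IE[c ->]; exists (c * s').
  by rewrite pbE; exact/esym/mul_linvK.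
move=> v; apply/idP/idP; first exact: Nsub.
rewrite -NE; apply: Smono => u [c ->]; apply/IE; exists (c * t').
by rewrite dE; exact/esym/mul_linvK.
Qed.

Lemma has_length_factorization (pis : seq Lam) :
  (forall p, p \in pis -> irreducible p) -> lam = \prod_(p <- pis) p ->
  has_length Q (size pis).
Proof.
move=> irr lamE; have [_ JS _ _] := latQ.
(* Suffix products: lam at index 0, giving the zero submodule, and 1 at index [size pis], giving all
   of Q. *)
pose b i := \prod_(p <- drop i pis) p.
have lamb i : left_mult (b i) lam.
  exists (\prod_(p <- take i pis) p).
  by rewrite /b lamE -big_cat cat_take_drop.
exists (fun i => Sb (left_mult (b i))); split=> [i _|v|v|i lt_i].
- by have [] := JS _ (left_mult_saturated lam1 (lamb i)).
- by rewrite -lattice_pred1 /b drop0 -lamE.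
- have [_ _ _ Smono] := latQ.
  rewrite -lattice_predT /b drop_size big_nil.
  by apply/idP/idP; apply: Smono => // u _; exists u; rewrite mulr1.
have bE : b i = nth 0 pis i * b i.+1 by rewrite /b (drop_nth 0) ?big_cons.
rewrite bE; apply: maximal_in_irreducible; first exact/irr/mem_nth.
by rewrite -bE.
Qed.

(** If lam = b c, consider the submodule of Lam c: if it is 0, then c is a multiple of lam and b is
    invertible; if it is Q, then c is invertible. *)
Lemma simple_irreducible : simple_module Q -> irreducible lam.
Proof.
have [NI JS Imono Smono] := latQ; case=> [[v v0] simpQ].
have klam : const_coef lam != 0 by rewrite lam1 oner_neq0.
split=> [|[u [ulam _]]|[b [c [[b0 nb] [c0 nc] lamE]]]]; first exact: comonic_neq0.
  case/negP: v0; change (v \in pred1 0); rewrite -lattice_pred1.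
  have : v \in Sb (fun _ => True) by rewrite lattice_predT.
  by apply: Smono => w _; exists (w * u); rewrite -mulrA ulam mulr1.
have := klam; rewrite lamE const_coefM mulf_eq0 negb_or => /andP[kb kc].
have satc : saturated lam (left_mult c).
  by apply: left_mult_saturated => //; exists b.
have [Scl Ic] := JS _ satc; have c_c := left_mult_refl c.
have lam_lam := left_mult_refl lam.
have [SE|SE] := simpQ _ Scl.
  have [_ Ilam] := JS _ (left_mult_saturated lam1 lam_lam).
  have [u cE] : left_mult lam c.
    apply/Ilam; apply: Imono ((Ic c).2 c_c) => w w_c.
    by rewrite lattice_pred1 -SE.
  apply: nb; apply: (linv_invertible kb (u := u)).
  apply/eqP; rewrite -subr_eq0; apply/eqP; apply: (mulr_const_coef_inj kc).
  by rewrite mulrBl mul1r -mulrA -lamE -cE subrr.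
have [_ IT] := JS _ satT.
have [u uc] : left_mult c 1.
  by apply/Ic; apply: Imono ((IT 1).2 Logic.I) => w _; rewrite SE.
exact/nc/(linv_invertible kc (esym uc)).
Qed.

Lemma irreducible_simple : irreducible lam -> simple_module Q.
Proof.
move=> irr; apply: has_length1_simple.
apply: (@has_length_factorization [:: lam]); last by rewrite big_seq1.
by move=> p; rewrite inE => /eqP->.
Qed.

End Lattice.
End SaturatedLattice.

(** * Submodules of V_lam as saturated ideals *)

Section CofactorModule.
Variables (K : fieldType) (X : choiceType).
Local Notation Lam := (free_alg K X).
Variable lam : Lam.
Local Notation V := (cofactor_module lam).
Implicit Types (v : V) (x : X) (J : Lam -> Prop).

Definition span_val v : Lam := cofactor_module_val v.

Lemma span_val_inj : injective span_val.
Proof. exact: val_inj. Qed.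

Lemma span_valP v : in_span lam (span_val v).
Proof. exact: valP v. Qed.

Lemma span_val_exists u : in_span lam u -> exists v, span_val v = u.
Proof. by move=> Vu; exists (CofactorModule Vu). Qed.

Lemma span_val0 : span_val 0 = 0.
Proof. exact: (raddf0 (val : V -> star_module lam)). Qed.

Lemma span_valD : {morph span_val : v w / v + w}.
Proof. exact: (raddfD (val : V -> star_module lam)). Qed.

Lemma span_valB : {morph span_val : v w / v - w}.
Proof. exact: (raddfB (val : V -> star_module lam)). Qed.

Lemma span_val_act a v :
  span_val (a *: v) = free_act a (span_val v : star_module lam).
Proof. exact: (linearZZ (val : {linear V -> star_module lam})). Qed.

Lemma span_valZ c v : span_val ((c%:MP : Lam) *: v) = c *: span_val v.
Proof. by rewrite span_val_act free_actU monom_act1. Qed.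

Lemma span_val_star x v : span_val (fvar K x *: v) = star lam x (span_val v).
Proof. by rewrite span_val_act; exact: fvar_scaleE. Qed.

Lemma star_stable_act S a u : star_stable lam S -> S u ->
  S (free_act a (u : star_module lam)).
Proof.
move=> Sst Su; apply: (star_stable_sum _ Sst) => m.
apply: (star_stableZ _ Sst).
exact: star_stable_word.
Qed.

Definition span_image (N : {pred V}) u : Prop := exists2 v, v \in N & span_val v = u.

Lemma span_image_stable N : submod_closed N -> star_stable lam (span_image N).
Proof.
move=> Ncl; have [N0 NP] := Ncl; split.
- by exists 0 => //; exact: span_val0.
- move=> c _ _ [v vN <-] [w wN <-]; exists ((c%:MP : Lam) *: v + w); first exact: NP.
  by rewrite span_valD span_valZ.
- move=> x _ [v vN <-]; exists (fvar K x *: v); first exact: submodZ.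
  exact: span_val_star.
Qed.

Definition span_part J : {pred V} := fun v => `[< J (span_val v) >].

Lemma absorb_mono (S S' : Lam -> Prop) : (forall u, S u -> S' u) ->
  forall u, absorb lam S u -> absorb lam S' u.
Proof. by move=> SS' u [n nu]; exists n => q /nu/SS'. Qed.

Lemma saturated_lattice_span : comonic lam ->
  saturated_lattice lam (fun N => absorb lam (span_image N)) span_part.
Proof.
move=> lam1; split.
- move=> N Ncl; have Nst := span_image_stable Ncl.
  split; first exact: absorb_saturated.
  move=> v; apply/asboolP/idP => [Av|vN]; last first.
    by exists 0%N => q _; apply: (star_stable_word _ Nst); exists v.
  have [|w wN /span_val_inj <- //] := absorb_in_span lam1 Nst _ (span_valP v) Av.
  by move=> _ [w _ <-]; apply: span_valP.
- move=> J Jsat; have Jst := saturated_stable Jsat; split.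
    split=> [|a v w /asboolP Jv /asboolP Jw]; apply/asboolP.
      by rewrite span_val0; case: Jst.
    rewrite span_valD span_val_act; apply: (star_stableD Jst) => //.
    exact: star_stable_act.
  move=> u; rewrite -(saturated_absorb_in_span u lam1 Jsat).
  split; apply: absorb_mono => w.
    by case=> v /asboolP Jv <-; split=> //; apply: span_valP.
  by case=> Jw /span_val_exists[v vE]; exists v => //; apply/asboolP; rewrite vE.
- by move=> N N' NN'; apply: absorb_mono => u [v /NN' vN' <-]; exists v.
- by move=> J J' JJ' v /asboolP/JJ' J'v; apply/asboolP.
Qed.

End CofactorModule.

(** * The Leavitt action on Lam modulo Lam lam *)

Section LeavittModule.
Variables (K : fieldType) (X : choiceType).
Local Notation Lam := (free_alg K X).
Local Notation F := (free_alg K (X + X)%type).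
Local Notation L := (leavitt K X).
Local Notation lo := (@leavitt_of K X).
Local Notation inc := (mmap (@malgC {fmonom (X + X)%type} K) (@fmonom_inl K X)).
Implicit Types (u v : Lam) (a b : F) (x : X) (J : Lam -> Prop) (l : L).

Definition leavitt_class a : L := to_quotring (@leavitt_rel K X) a.

Definition fvar_mul x u : Lam := fvar K x * u.

Fact fvar_mul_is_linear x : linear (fvar_mul x).
Proof. by move=> c u v; rewrite /fvar_mul mulrDr malgZ_mulr. Qed.
HB.instance Definition _ x :=
  GRing.isLinear.Build K Lam Lam *:%R (fvar_mul x) (fvar_mul_is_linear x).

Section Action.
Variable lam : Lam.
Hypothesis lam1 : comonic lam.

(* The Leavitt relations hold for this action only modulo Lam * lam. *)
Definition leavitt_gen (z : X + X) : {linear Lam -> Lam} :=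
  match z with inl x => fvar_mul x | inr x => star lam x end.

Definition leavitt_act a u : Lam := free_act a (u : free_module leavitt_gen).

Lemma leavitt_actD a b u : leavitt_act (a + b) u = leavitt_act a u + leavitt_act b u.
Proof. exact: free_actDl. Qed.

Lemma leavitt_actN a u : leavitt_act (- a) u = - leavitt_act a u.
Proof.
apply/eqP; rewrite -addr_eq0 -leavitt_actD addNr.
by apply/eqP; apply: free_act0.
Qed.

Lemma leavitt_actM a b u : leavitt_act (a * b) u = leavitt_act a (leavitt_act b u).
Proof. exact/esym/free_actA. Qed.

Lemma leavitt_act1 u : leavitt_act 1 u = u.
Proof. exact: free_act1. Qed.

Lemma leavitt_act_var z u : leavitt_act (fvar K z) u = leavitt_gen z u.
Proof. exact: (fvar_scaleE z (u : free_module leavitt_gen)). Qed.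

Lemma leavitt_act_sum I (r : seq I) (G : I -> F) u :
  leavitt_act (\sum_(i <- r) G i) u = \sum_(i <- r) leavitt_act (G i) u.
Proof. exact: free_act_suml. Qed.

Lemma leavitt_act_inc u v : leavitt_act (inc u) v = u * v.
Proof.
rewrite /mmap leavitt_act_sum [in RHS](monalgE u) mulr_suml.
apply: eq_bigr => -[w] _; rewrite mul_malgC.
rewrite [LHS](_ : _ = u@_(FMonom w) *: leavitt_act (fmonom_inl K (FMonom w)) v); last first.
  rewrite -mul_malgC leavitt_actM [LHS]/leavitt_act free_actU.
  by rewrite (monom_act1 leavitt_gen).
rewrite -[<< _ *g _ >>](_ : u@_(FMonom w) *: << FMonom w >> = _); last first.
  by rewrite -mul_malgC malgM_def fgmulUU mulr1 Monoid.mul1m.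
rewrite -scalerAl; congr (_ *: _).
rewrite /leavitt_act free_actU scale1r /monom_act /=.
elim: w => [|x w IHw] /=.
  have -> : FMonom [::] = @mone {fmonom X} by apply/eqP; rewrite fmP fm1.
  exact/esym/mul1r.
rewrite IHw /fvar_mul mulrA; congr (_ * _).
rewrite malgM_def fgmulUU mulr1; congr << _ >>.
by apply/eqP; rewrite fmP fmM fmU.
Qed.

Lemma leavitt_act_inc1 u : leavitt_act (inc u) 1 = u.
Proof. by rewrite leavitt_act_inc mulr1. Qed.

Lemma saturated_act J a u : saturated lam J -> J u -> J (leavitt_act a u).
Proof.
move=> Jsat Ju; have Jst := saturated_stable Jsat.
apply: (star_stable_sum _ Jst) => -[w]; apply: (star_stableZ _ Jst).
rewrite /monom_act /=; elim: w => //= -[] x w IHw /=.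
  exact: (saturatedM _ Jsat).
by case: Jsat => _ _ _; apply.
Qed.

Lemma leavitt_rel_act a u :
  leavitt_rel a -> left_mult lam (leavitt_act a u).
Proof.
have lsat := left_mult_saturated lam1 (left_mult_refl lam).
case=> [x|x y xy|s s_uniq s_all]; rewrite ?leavitt_actD ?leavitt_actN ?leavitt_act1.
- rewrite leavitt_actM !leavitt_act_var /= star_fvarM eqxx mulr1n subrr.
  exact: left_mult0.
- rewrite leavitt_actM !leavitt_act_var /= star_fvarM (negPf xy) mulr0n.
  exact: left_mult0.
rewrite leavitt_act_sum.
(* Every star y kills the sum of the x star x u minus u, which therefore lies in Lam lam. *)
apply: (saturated_star lam1 lsat) => y.
rewrite (_ : star lam y _ = 0); first exact: left_mult0.
rewrite raddfB raddf_sum /= (bigD1_seq y) //= big1_seq => [|x /andP[xy _]].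
  rewrite addr0 leavitt_actM !leavitt_act_var /= star_fvarM eqxx mulr1n.
  exact: subrr.
by rewrite leavitt_actM !leavitt_act_var /= star_fvarM (negPf xy).
Qed.

Lemma in_ideal_act a u :
  in_ideal (@leavitt_rel K X) a -> left_mult lam (leavitt_act a u).
Proof.
have lsat := left_mult_saturated lam1 (left_mult_refl lam).
move=> aI; elim: aI u => {a} [a /leavitt_rel_act//||a b _ IHa _ IHb|a b _ IHb|a b _ IHa] u.
- rewrite /leavitt_act free_act0; exact: left_mult0.
- rewrite leavitt_actD leavitt_actN; apply: (star_stableB (saturated_stable lsat)).
    exact: IHa.
  exact: IHb.
- by rewrite leavitt_actM; apply: saturated_act.
- by rewrite leavitt_actM.
Qed.

(** Injectivity of Lam / Lam lam -> M: let both sides of u = b lam act on 1; the left gives u, the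
    right the image of lam under b, which stays in the saturated ideal Lam lam. *)
Lemma leavitt_of_lideal u : lo u \in lideal (lo lam) <-> left_mult lam u.
Proof.
split=> [/asboolP[l]|[a ->]]; last first.
  by apply/asboolP; exists (lo a); rewrite rmorphM.
have [b ->] : exists b, l = leavitt_class b by exists (repr l); apply/esym/to_quotringK.
rewrite -[RHS]/(quotring_mul _ _) quotring_mulE => /to_quotringP.
move/(in_ideal_act 1); rewrite leavitt_actD leavitt_actN leavitt_actM => h.
have lsat := left_mult_saturated lam1 (left_mult_refl lam).
have bI := saturated_act b lsat (left_mult_refl lam).
have uI : left_mult lam (u - leavitt_act b lam).
  suff <- : leavitt_act (inc u) 1 - leavitt_act b (leavitt_act (inc lam) 1)
     = u - leavitt_act b lam by exact: h.
  congr (_ - leavitt_act b _); exact: leavitt_act_inc1.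
have := star_stableD (saturated_stable lsat) uI bI.
by rewrite subrK.
Qed.

End Action.
End LeavittModule.

(** * Cyclic modules, and submodules of M as saturated ideals *)

Section CyclicModuleTheory.
Variables (R : pzRingType) (a : R).

Definition cyc (r : R) : cyclic_module a := to_quotmod (lideal_closed a) r.

Lemma cycB r s : cyc (r - s) = cyc r - cyc s.
Proof. exact: (raddfB (to_quotmod (lideal_closed a))). Qed.

Lemma cycD r s : cyc (r + s) = cyc r + cyc s.
Proof. exact: (raddfD (to_quotmod (lideal_closed a))). Qed.

Lemma cyc0 : cyc 0 = 0.
Proof. exact: (raddf0 (to_quotmod (lideal_closed a))). Qed.

Lemma cycZ r s : cyc (r * s) = r *: cyc s.
Proof. exact: (linearZZ (to_quotmod (lideal_closed a))). Qed.

Lemma cyc_mulDl0 r p q t :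
  cyc (p * t) = 0 -> cyc ((r * p + q) * t) = cyc (q * t).
Proof. by move=> pt0; rewrite mulrDl cycD -mulrA cycZ pt0 scaler0 add0r. Qed.

Lemma cyc_surj m : exists r, m = cyc r.
Proof. by exists (repr m); apply/esym/to_quotmodK. Qed.

Lemma cyc_eq0 r : cyc r = 0 <-> exists s, r = s * a.
Proof.
rewrite -cyc0; split=> [/to_quotmodP|[s ->]]; first by rewrite subr0 => /asboolP.
by apply/to_quotmodP; rewrite subr0; apply/asboolP; exists s.
Qed.

End CyclicModuleTheory.

Section LeavittLattice.
Variables (K : fieldType) (X : choiceType).
Local Notation Lam := (free_alg K X).
Local Notation F := (free_alg K (X + X)%type).
Local Notation L := (leavitt K X).
Local Notation lo := (@leavitt_of K X).
Implicit Types (u v : Lam) (a b : F) (x : X) (J : Lam -> Prop) (l : L).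

Definition svar x : L := leavitt_class (fvar K (inr x)).

Lemma leavitt_classM a b : leavitt_class (a * b) = leavitt_class a * leavitt_class b.
Proof. exact/esym/quotring_mulE. Qed.

Lemma leavitt_classD a b : leavitt_class (a + b) = leavitt_class a + leavitt_class b.
Proof. exact: (raddfD (to_quotring (@leavitt_rel K X))). Qed.

Lemma leavitt_class0 : leavitt_class 0 = 0 :> L.
Proof. exact: (raddf0 (to_quotring (@leavitt_rel K X))). Qed.

Lemma leavitt_class_surj l : exists a, l = leavitt_class a.
Proof. by exists (repr l); apply/esym/to_quotringK. Qed.

Lemma svar_fvar x y : svar x * lo (fvar K y) = (y == x)%:R.
Proof.
rewrite leavitt_of_var -leavitt_classM; case: eqVneq => [->|yx].
  apply: (etrans (y := leavitt_class 1)) => //.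
  exact/to_quotringP/in_ideal_gen/leavitt_same.
apply: (etrans (y := leavitt_class 0)); last exact: leavitt_class0.
apply/(to_quotringP (@leavitt_rel K X)).
by rewrite subr0; apply/in_ideal_gen/leavitt_diff.
Qed.

Lemma leavitt_ofC (c : K) : lo c%:MP = leavitt_class c%:MP.
Proof. by rewrite /leavitt_of mmapC. Qed.

Lemma svar_leavitt_of x u : const_coef u = 0 -> svar x * lo u = lo (cofactor x u).
Proof.
move=> u0; have [s [s_uniq uE]] := cofactor_decomp u.
have [_ cof] := cofactor_unique s_uniq uE.
rewrite {1}uE u0 malgC0E add0r raddf_sum mulr_sumr /=.
under eq_bigr => y _ do rewrite rmorphM mulrA svar_fvar /=.
have [xs|xNs] := boolP (x \in s).
  rewrite (bigD1_seq x) //= eqxx mul1r big1 ?addr0 // => y /negPf ->.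
  by rewrite mul0r.
rewrite cof (negPf xNs) raddf0 big_seq big1 // => y ys.
by case: eqVneq => [yx|_]; [rewrite -yx ys in xNs | rewrite mul0r].
Qed.

Variable lam : Lam.
Hypothesis lam1 : comonic lam.
Local Notation M := (cyclic_module (lo lam)).

Definition lcyc u : M := cyc (lo lam) (lo u).

Lemma lcycB u v : lcyc (u - v) = lcyc u - lcyc v.
Proof. by rewrite /lcyc raddfB cycB. Qed.

Lemma lcycD u v : lcyc (u + v) = lcyc u + lcyc v.
Proof. by rewrite /lcyc raddfD cycD. Qed.

Lemma lcyc0 : lcyc 0 = 0.
Proof. by rewrite /lcyc raddf0 cyc0. Qed.

Lemma lcycM u v : lcyc (u * v) = lo u *: lcyc v.
Proof. by rewrite /lcyc rmorphM cycZ. Qed.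

Lemma lcycP (a u v : Lam) : lcyc (a * u + v) = lo a *: lcyc u + lcyc v.
Proof. exact: etrans (lcycD _ _) (congr1 (+%R^~ (lcyc v)) (lcycM a u)). Qed.

Lemma lcyc_eq0 u : lcyc u = 0 <-> left_mult lam u.
Proof.
rewrite -(leavitt_of_lideal lam1) cyc_eq0; split=> [h|/asboolP //]; exact/asboolP.
Qed.

Lemma lcyc_lam : lcyc lam = 0.
Proof. exact/lcyc_eq0/left_mult_refl. Qed.

(** Subtracting k_u lam keeps the class of u and removes its constant term; then x^* takes the
    x-cofactor. *)
Lemma lcyc_star x u : lcyc (star lam x u) = svar x *: lcyc u.
Proof.
pose w := u - const_coef u *: lam.
have w0 : const_coef w = 0 by rewrite const_coefB const_coefZ lam1 mulr1 subrr.
have -> : lcyc u = lcyc w.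
  by rewrite lcycB -mul_malgC lcycM lcyc_lam scaler0 subr0.
rewrite /lcyc -cycZ (svar_leavitt_of x w0); congr (cyc _ (lo _)).
by rewrite /w raddfB /= [X in _ = _ - X]linearZZ addrC.
Qed.

(** The generators x and x^* act by multiplication and by star, and both preserve J. With J all of
    Lam and u = 1, this shows that Lam maps onto M. *)
Lemma saturated_leavitt_class J a u : saturated lam J -> J u ->
  exists2 v, J v & leavitt_class a *: lcyc u = lcyc v.
Proof.
move=> Jsat; have [Jlam J0 JP Jx] := Jsat; have Jst := saturated_stable Jsat.
elim/cofactor_ind: a u => [|a IHa] u Ju.
  by exists 0 => //; rewrite lcyc0 leavitt_class0 scale0r.
have [s [_ ->]] := cofactor_decomp a; rewrite leavitt_classD scalerDl.
have [v Jv ->] : exists2 v, J v &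
    leavitt_class (\sum_(z <- s) fvar K z * cofactor z a) *: lcyc u = lcyc v.
  elim: s => [|z s [v Jv vE]].
    by exists 0 => //; rewrite big_nil lcyc0 leavitt_class0 scale0r.
  rewrite big_cons leavitt_classD scalerDl vE leavitt_classM -scalerA.
  have [w Jw ->] := IHa z u Ju; case: z {IHa vE} => x.
    exists (fvar K x * w + v); first exact: JP.
    by rewrite lcycP leavitt_of_var.
  exists (star lam x w + v); first exact/(star_stableD Jst)/Jv/Jx.
  by rewrite lcycD lcyc_star.
exists ((const_coef a)%:MP * u + v); first exact: JP.
by rewrite lcycP leavitt_ofC.
Qed.

Lemma lcyc_surj (m : M) : exists u, m = lcyc u.
Proof.
have [l ->] := cyc_surj m; have [a ->] := leavitt_class_surj l.
have [v _ vE] := @saturated_leavitt_class (fun _ => True) a 1 (And4 Logic.I Logic.I (fun _ _ _ _ _ => Logic.I) (fun _ _ _ => Logic.I)) Logic.I.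
by exists v; rewrite -vE /lcyc rmorph1 -cycZ mulr1.
Qed.

Lemma leavitt_split l : exists u r, l = r * lo lam + lo u.
Proof.
have [u lE] := lcyc_surj (cyc (lo lam) l).
have /cyc_eq0[r lu] : cyc (lo lam) (l - lo u) = 0.
  by apply/eqP; rewrite cycB subr_eq0; apply/eqP.
by exists u, r; rewrite -lu subrK.
Qed.

Lemma cyc_split r u : cyc (lo lam) (r * lo lam + lo u) = lcyc u.
Proof.
rewrite cycD; have -> : cyc (lo lam) (r * lo lam) = 0 by apply/cyc_eq0; exists r.
exact: add0r.
Qed.

Definition leavitt_part (N : {pred M}) u : Prop := lcyc u \in N.

Definition leavitt_image J : {pred M} := fun m => `[< exists2 u, J u & m = lcyc u >].

Lemma saturated_lattice_leavitt :
  saturated_lattice lam leavitt_part leavitt_image.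
Proof.
split.
- move=> N Ncl; have [N0 NP] := Ncl; split.
    split=> [||a u v uN vN|x u uN]; rewrite /leavitt_part.
    - by rewrite lcyc_lam.
    - by rewrite lcyc0.
    - rewrite lcycP; exact: NP (lo a) _ _ uN vN.
    - by rewrite lcyc_star; apply: submodZ.
  move=> m; apply/asboolP/idP => [[u uN ->] //|mN].
  by have [u mE] := lcyc_surj m; exists u => //; rewrite /leavitt_part -mE.
- move=> J Jsat; have [Jlam J0 JP Jx] := Jsat; split.
    split=> [|l _ _ /asboolP[u Ju ->] /asboolP[v Jv ->]]; apply/asboolP.
      by exists 0; rewrite ?lcyc0.
    have [a ->] := leavitt_class_surj l; have [w Jw ->] := saturated_leavitt_class a Jsat Ju.
    exists (w + v); last by rewrite lcycD.
    exact/(star_stableD (saturated_stable Jsat)).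
  move=> u; split=> [/asboolP[v Jv uv]|Ju]; last by apply/asboolP; exists u.
  have [c uvE] : left_mult lam (u - v) by apply/lcyc_eq0; rewrite lcycB uv subrr.
  by rewrite -(subrK v u) uvE; apply: JP.
- by move=> N N' NN' u; apply: NN'.
- move=> J J' JJ' m /asboolP[u /JJ' J'u mE]; apply/asboolP; by exists u.
Qed.

End LeavittLattice.

(** * Isomorphisms of cyclic modules over Lam and over the Leavitt algebra *)

Lemma inj_surj_bijective (A B : Type) (f : A -> B) :
  injective f -> (forall y, exists x, f x = y) -> bijective f.
Proof.
move=> finj /choice[g gK]; exists g => // x; exact/finj/gK.
Qed.

Section Isomorphic.
Variable R : pzRingType.

Lemma isomorphic_sym (V W : lmodType R) : isomorphic V W -> isomorphic W V.
Proof.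
case=> f [g fK gK].
have g_lin : linear g.
  by move=> c u v; apply: (can_inj fK); rewrite linearP !gK.
pose h : {linear W -> V} := HB.pack g (GRing.isLinear.Build R W V *:%R g g_lin).
by exists h; exists f.
Qed.

(* s represents the image of 1 under an isomorphism from R / Ra to R / Rb. *)
Definition similarity_witness (a b s : R) : Prop :=
  [/\ cyc b (a * s) = 0, forall u, cyc b (u * s) = 0 -> cyc a u = 0
    & exists t, cyc b (t * s) = cyc b 1].

Lemma isomorphic_cyclicP (a b : R) :
  isomorphic (cyclic_module a) (cyclic_module b) <->
  exists s, similarity_witness a b s.
Proof.
have cyca r : cyc a (r * a) = 0 by apply/cyc_eq0; exists r.
split=> [[f [g fK gK]]|[s [as0 inj [t ts]]]].
  have [s fs] := cyc_surj (f (cyc a 1)).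
  have fE u : f (cyc a u) = cyc b (u * s).
    by rewrite -[u in LHS]mulr1 cycZ linearZZ fs -cycZ.
  exists s; split; first by rewrite -fE -[X in cyc a X]mul1r cyca raddf0.
    by move=> u; rewrite -fE -(raddf0 f) => /(can_inj fK).
  have [t gE] := cyc_surj (g (cyc b 1)).
  by exists t; rewrite -fE -gE gK.
pose f (m : cyclic_module a) : cyclic_module b := cyc b (repr m * s).
have fE u : f (cyc a u) = cyc b (u * s).
  apply/eqP; rewrite -subr_eq0 -cycB -mulrBl; apply/eqP.
  have /cyc_eq0[r ->] : cyc a (repr (cyc a u) - u) = 0.
    by rewrite cycB [cyc a (repr _)]to_quotmodK subrr.
  by rewrite -mulrA cycZ as0 scaler0.
have f_lin : linear f.
  move=> c m n; have [u ->] := cyc_surj m; have [v ->] := cyc_surj n.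
  by rewrite -cycZ -cycD !fE mulrDl cycD -mulrA cycZ.
pose h : {linear cyclic_module a -> cyclic_module b} :=
  HB.pack f (GRing.isLinear.Build R (cyclic_module a) (cyclic_module b) *:%R f f_lin).
exists h; apply: inj_surj_bijective => [m n|m].
  have [u ->] := cyc_surj m; have [v ->] := cyc_surj n => /eqP.
  rewrite [h _]fE [h _]fE -subr_eq0 -cycB -mulrBl => /eqP/inj/eqP.
  by rewrite cycB subr_eq0 => /eqP.
have [u ->] := cyc_surj m; exists (cyc a (u * t)).
by rewrite [h _]fE -mulrA cycZ ts -cycZ mulr1.
Qed.

End Isomorphic.

Section Similarity.
Variables (K : fieldType) (X : choiceType).
Local Notation Lam := (free_alg K X).
Local Notation lo := (@leavitt_of K X).
Implicit Types (u v s : Lam).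
Variables gam lam : Lam.
Hypotheses (gam1 : comonic gam) (lam1 : comonic lam).

Lemma cyc_left_mult b u : cyc b u = 0 <-> left_mult b u.
Proof. exact: cyc_eq0. Qed.

(** By [leavitt_split] a witness over the Leavitt algebra may be replaced by one from Lam, and a
    class of Lam vanishes in M exactly when it vanishes in Lam / Lam lam. *)
Lemma similarity_leavitt :
  (exists s, similarity_witness gam lam s) <->
  (exists l, similarity_witness (lo gam) (lo lam) l).
Proof.
have lcycP u : lcyc lam u = 0 <-> cyc lam u = 0 by rewrite lcyc_eq0 // cyc_left_mult.
have clP' u : lcyc gam u = 0 <-> cyc gam u = 0 by rewrite lcyc_eq0 // cyc_left_mult.
have cl_eq u v : lcyc lam u = lcyc lam v <-> cyc lam u = cyc lam v.
  split=> uv; apply/eqP; rewrite -subr_eq0; apply/eqP.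
    by rewrite -cycB; apply/lcycP; rewrite lcycB uv subrr.
  by rewrite -lcycB; apply/lcycP; rewrite cycB uv subrr.
split=> [[s [gs0 inj [t ts]]]|[l [gl0 inj [t tl]]]].
  have loM u : cyc (lo lam) (lo u * lo s) = lcyc lam (u * s) by rewrite lcycM cycZ.
  have loM' r u : cyc (lo lam) ((r * lo gam + lo u) * lo s) = lcyc lam (u * s).
    have gs : cyc (lo lam) (lo gam * lo s) = 0 by rewrite loM; apply/lcycP.
    exact: etrans (cyc_mulDl0 r (lo u) gs) (loM u).
  exists (lo s); split; first by rewrite loM; apply/lcycP.
    move=> l; have [u [r ->]] := leavitt_split gam1 l.
    move/(etrans (esym (loM' r u)))/lcycP/inj/clP' => u0.
    exact: etrans (cyc_split gam r u) u0.
  exists (lo t); apply: etrans (loM t) _; rewrite -(rmorph1 lo).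
  exact/cl_eq.
have [s [q lE]] := leavitt_split lam1 l.
have loM u : cyc (lo lam) (lo u * l) = lcyc lam (u * s).
  by rewrite cycZ lE cyc_split // lcycM.
exists s; split; first by apply/lcycP; rewrite -loM.
  by move=> u /lcycP us0; apply/clP'/inj/(etrans (loM u)).
have [u [r tE]] := leavitt_split gam1 t; exists u; apply/cl_eq.
apply: etrans (esym (loM u)) _; rewrite /lcyc rmorph1 -tl tE.
exact/esym/cyc_mulDl0.
Qed.

End Similarity.

(** * Isomorphisms between V_gam and V_lam versus similarity *)

Lemma star_diffE (F : pzRingType) (V : lmodType F) (k l : F) (p q r t : V) :
  - ((k * l) *: p) + (q + k *: r) - (- (k *: t) + q) =
  k *: (- ((1 * l) *: p) + (t + 1 *: r)).
Proof.
rewrite mul1r scale1r !scalerDr scalerN scalerA opprD opprK -addrA; congr (_ + _).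
by rewrite [q + _]addrC addrACA subrr addr0 addrC.
Qed.

Section SpanIsomorphism.
Variables (K : fieldType) (X : choiceType).
Local Notation Lam := (free_alg K X).
Implicit Types (u s : Lam) (x : X) (q : seq X).
Variables gam lam : Lam.
Hypotheses (gam1 : comonic gam) (lam1 : comonic lam).
Local Notation J := (left_mult lam).

Let Jsat : saturated lam J. Proof. exact/left_mult_saturated/left_mult_refl. Qed.
Let Jst : star_stable lam J. Proof. exact: saturated_stable. Qed.

(** The failure of u -> u s to intertwine the two star actions depends on s only through gam s. *)
Lemma star_mulr_diff x u s :
  star lam x (u * s) - star gam x u * s = const_coef u *: star lam x (gam * s).
Proof.
have gE : star gam x u * s =
    - (const_coef u *: (cofactor x gam * s)) + cofactor x u * s.
  by rewrite /star mulrDl mulNr -scalerAl.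
have lE := starM lam x gam s; rewrite gam1 in lE.
apply: etrans (congr2 (fun y z => y - z) (starM lam x u s) gE) _.
apply: etrans _ (esym (congr1 (fun z => const_coef u *: z) lE)).
exact: star_diffE.
Qed.

Section Intertwine.
Variable s : Lam.
Hypothesis gs : J (gam * s).

Lemma star_intertwine x u : J (star lam x (u * s) - star gam x u * s).
Proof.
rewrite star_mulr_diff; apply: (star_stableZ _ Jst).
by case: Jsat => _ _ _; apply.
Qed.

Lemma star_word_intertwine q u :
  J (star_word lam q (u * s) - star_word gam q u * s).
Proof.
elim: q => [|x q IHq]; first by rewrite subrr; exact: left_mult0.
rewrite !star_word_cons.
have Jx : J (star lam x (star_word lam q (u * s) - star_word gam q u * s)).
  by case: Jsat => _ _ _; apply.
have := star_stableD Jst Jx (star_intertwine x (star_word gam q u)).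
by rewrite raddfB /= addrA subrK.
Qed.

End Intertwine.

Lemma cong_trans (u v w : Lam) : J (u - v) -> J (v - w) -> J (u - w).
Proof.
by move=> uv vw; have := star_stableD Jst uv vw; rewrite addrA subrK.
Qed.

Local Notation Vg := (cofactor_module gam).
Local Notation Vl := (cofactor_module lam).

(** The isomorphism sends v to the element of V_lam congruent to v s modulo Lam lam, unique because
    V_lam meets Lam lam in 0. *)
Lemma witness_span_isomorphic s : similarity_witness gam lam s ->
  isomorphic Vg Vl.
Proof.
case=> /cyc_left_mult gs inj [t ts].
have Jt : J (1 - t * s) by apply/cyc_left_mult; rewrite cycB ts subrr.
have Vgst := star_stable_span gam; have Vlst := star_stable_span lam.
pose rel (w : Vl) (v : Vg) := J (span_val w - span_val v * s).
have relD w w' v v' : rel w v -> rel w' v' -> rel (w + w') (v + v').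
  move=> wv wv'; rewrite /rel !span_valD mulrDl opprD addrACA.
  exact: (star_stableD Jst wv wv').
have rel0 : rel 0 0.
  by rewrite /rel !span_val0 mul0r subrr; exact: left_mult0.
have rel_ext w w' v v' : w = w' -> v = v' -> rel w v -> rel w' v'.
  by move=> -> ->.
have relZ (a : Lam) w v : rel w v -> rel (a *: w) (a *: v).
  have relDl (a1 a2 : Lam) w1 v1 : rel (a1 *: w1) (a1 *: v1) ->
      rel (a2 *: w1) (a2 *: v1) -> rel ((a1 + a2) *: w1) ((a1 + a2) *: v1).
    move=> r1 r2.
    exact: rel_ext (esym (scalerDl _ _ _)) (esym (scalerDl _ _ _)) (relD _ _ _ _ r1 r2).
  have relS0 w1 v1 : rel ((0 : Lam) *: w1) ((0 : Lam) *: v1).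
    exact: rel_ext (esym (scale0r _)) (esym (scale0r _)) rel0.
  elim/cofactor_ind: a w v => [|a IHa] w v wv; first exact: relS0.
  have [r [_ ->]] := cofactor_decomp a; apply: (relDl).
    by rewrite /rel !span_valZ -scalerAl -scalerBr; exact: (star_stableZ _ Jst).
  elim: r => [|x r IHr]; first by rewrite big_nil; exact: relS0.
  rewrite big_cons; apply: (relDl _ _ _ _ _ IHr).
  apply: rel_ext (scalerA _ _ _) (scalerA _ _ _) _.
  rewrite /rel (span_val_star x (_ *: w)) (span_val_star x (_ *: v)).
  apply: (cong_trans (v := star lam x (span_val (cofactor x a *: v) * s))).
    rewrite -raddfB /=; case: Jsat => _ _ _; apply; exact: IHa.
  exact: star_intertwine.
have rel_inj w w' v : rel w v -> rel w' v -> w = w'.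
  move=> wv wv'; apply/span_val_inj/eqP; rewrite -subr_eq0; apply/eqP.
  rewrite -span_valB; apply: (in_span_left_mult lam1); first exact: span_valP.
  by have := star_stableB Jst wv wv'; rewrite span_valB opprB addrA subrK.
(* The u with u s congruent to an element of V_lam form a star-stable space for gam that absorbs 1,
   so it contains V_gam. *)
have ex_rel v : exists w, rel w v.
  pose S u := exists2 w : Lam, in_span lam w & J (w - u * s).
  suff [w /span_val_exists[w' <-] wv] : S (span_val v) by exists w'.
  apply: (in_span_absorb1 gam1 (S := S) _ _ (span_valP v)).
    split=> [|c u u' [w Vw wu] [w' Vw' wu']|x u [w Vw wu]].
    - by exists 0; [case: Vlst | rewrite mul0r subrr; exact: left_mult0].
    - exists (c *: w + w'); first by case: Vlst => _ VP _; apply: VP.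
      rewrite mulrDl -scalerAl opprD addrACA -scalerBr.
      exact: (star_stableD Jst (star_stableZ c Jst wu) wu').
    - exists (star lam x w); first by case: Vlst => _ _; apply.
      apply: cong_trans (star_intertwine gs x u).
      by rewrite -raddfB /=; case: Jsat => _ _ _; apply.
  have [n sn] := absorb_span lam (1 * s); exists n => q /sn Vq.
  exists (star_word lam q (1 * s)); first exact: Vq.
  exact: (star_word_intertwine gs q 1).
have [f fP] := choice ex_rel.
have f_lin : linear f.
  move=> c u v; apply: rel_inj (fP _) _.
  exact: relD (relZ c _ _ (fP u)) (fP v).
pose h : {linear Vg -> Vl} := HB.pack f (GRing.isLinear.Build Lam Vg Vl *:%R f f_lin).
exists h; apply: inj_surj_bijective => [v v' fvv'|w].
  apply/span_val_inj/eqP; rewrite -subr_eq0; apply/eqP; rewrite -span_valB.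
  apply: (in_span_left_mult gam1); first exact: span_valP.
  apply/cyc_left_mult/inj/cyc_left_mult.
  have fv := fP v; rewrite (fvv' : f v = f v') in fv.
  have := star_stableB Jst (fP v') fv.
  by rewrite opprB addrC addrA subrK span_valB mulrBl.
(* Surjectivity by the same argument over lam; 1 is absorbed since it is congruent to t s. *)
pose S u := exists2 v : Lam, in_span gam v & J (u - v * s).
suff [v /span_val_exists[v' <-] wv] : S (span_val w).
  by exists v'; apply: rel_inj (fP v') wv.
apply: (in_span_absorb1 lam1 (S := S) _ _ (span_valP w)).
  split=> [|c u u' [v Vv uv] [v' Vv' uv']|x u [v Vv uv]].
  - by exists 0; [case: Vgst | rewrite mul0r subrr; exact: left_mult0].
  - exists (c *: v + v'); first by case: Vgst => _ VP _; apply: VP.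
    rewrite mulrDl -scalerAl opprD addrACA -scalerBr.
    exact: (star_stableD Jst (star_stableZ c Jst uv) uv').
  - exists (star gam x v); first by case: Vgst => _ _; apply.
    apply: cong_trans (star_intertwine gs x v).
    by rewrite -raddfB /=; case: Jsat => _ _ _; apply.
have [n tn] := absorb_span gam t; exists n => q /tn Vq.
exists (star_word gam q t); first exact: Vq.
apply: cong_trans (star_word_intertwine gs q t).
by have := star_stable_word q Jst Jt; rewrite star_wordB.
Qed.

Lemma span_isomorphic_witness :
  isomorphic Vg Vl -> exists s, similarity_witness gam lam s.
Proof.
case=> phi [psi phiK psiK].
have Vgst := star_stable_span gam.
pose g x : Vg := CofactorModule (in_span_cofactor1 gam x).
have gE x : span_val (g x) = cofactor x gam by [].
have [s0 [s0_uniq gamE]] := cofactor_decomp gam.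
have [_ cof] := cofactor_unique s0_uniq gamE.
(* This choice is forced modulo Lam lam: gam s = s + sum_x x gam_x s must vanish, and gam_x s should
   be phi of gam_x. *)
pose s := - \sum_(x <- s0) fvar K x * span_val (phi (g x)).
pose e (v : Vg) := span_val v * s - span_val (phi v).
have eD v w : e (v + w) = e v + e w.
  by rewrite /e linearD !span_valD mulrDl opprD addrACA.
have eZ c v : e ((c%:MP : Lam) *: v) = c *: e v.
  by rewrite /e linearZZ !span_valZ -scalerAl scalerBr.
have e0 : e 0 = 0 by rewrite /e raddf0 !span_val0 mul0r subrr.
have gamsE : gam * s = \sum_(x <- s0) fvar K x * e (g x).
  rewrite {1}gamE gam1 mpolyC1E mulrDl mul1r mulr_suml {1}/s addrC -sumrB.
  by apply: eq_bigr => x _; rewrite -mulrA -mulrBr.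
have star_gams x : star lam x (gam * s) = e (g x).
  rewrite gamsE raddf_sum /=.
  under eq_bigr => y _ do rewrite star_fvarM.
  have [xs|xNs] := boolP (x \in s0).
    by rewrite (bigD1_seq x) //= eqxx big1 ?addr0 // => y /negPf ->.
  have -> : g x = 0.
    by apply: span_val_inj; rewrite gE cof (negPf xNs) span_val0.
  rewrite e0 big_seq big1 // => y ys.
  by case: eqVneq => [yx|//]; rewrite -yx ys in xNs.
(* The argument of [e] on the right is the x-cofactor of v, so [Je] follows by induction on the
   degree. *)
have star_e x v : star lam x (e v) =
    e (fvar K x *: v + ((const_coef (span_val v))%:MP : Lam) *: g x).
  rewrite eD eZ -star_gams -star_mulr_diff /e linearZZ !span_val_star raddfB /=.
  by rewrite [RHS]addrC addrA subrK.
have Je v : J (e v).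
  have [u uE] : exists u, span_val v = u by exists (span_val v).
  elim/cofactor_ind: u v uE => [|u IHu] v uE.
    have -> : v = 0 by apply: span_val_inj; rewrite uE span_val0.
    by rewrite e0; exact: left_mult0.
  apply: (saturated_star lam1 Jsat) => x; rewrite star_e; apply: (IHu x).
  by rewrite span_valD span_valZ span_val_star gE uE -cofactorE_star.
have gs : J (gam * s).
  by apply: (saturated_star lam1 Jsat) => x; rewrite star_gams.
exists s; split; first exact/cyc_left_mult.
  move=> u /cyc_left_mult us; apply/cyc_left_mult.
  apply: (saturated_absorb gam1 (left_mult_saturated gam1 (left_mult_refl gam))).
  (* A long word brings u to some v in V_gam with v s in Lam lam; then phi v lies in V_lam and in
     Lam lam, so v = 0. *)
  have [n un] := absorb_span gam u; exists n => q /un/span_val_exists[v vE].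
  rewrite -vE; suff -> : v = 0 by rewrite span_val0; exact: left_mult0.
  apply: (can_inj phiK); rewrite raddf0; apply: span_val_inj; rewrite span_val0.
  apply: (in_span_left_mult lam1); first exact: span_valP.
  have := star_stableB Jst (star_word_intertwine gs q u) (star_stable_word q Jst us).
  rewrite addrAC subrr sub0r -vE => /(star_stableD Jst)/(_ (Je v)).
  by rewrite /e addKr => /(star_stableZ (-1) Jst); rewrite scaleN1r opprK.
(* Lam s + Lam lam is saturated and contains V_lam, as phi is onto; by absorption it contains 1. *)
have Jt_sat : saturated lam (fun u => exists t, J (u - t * s)).
  split.
  - by exists 0; rewrite mul0r subr0; exact: left_mult_refl.
  - by exists 0; rewrite mul0r subrr; exact: left_mult0.
  - move=> a u v [t ut] [t' vt']; exists (a * t + t').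
    rewrite mulrDl opprD addrACA -mulrA -mulrBr.
    by have [_ _ JP _] := Jsat; exact: (JP a _ _ ut vt').
  - move=> x u [t ut]; exists (star gam x t).
    apply: cong_trans (star_intertwine gs x t).
    by rewrite -raddfB /=; case: Jsat => _ _ _; apply.
have [|t ts] := saturated_absorb lam1 Jt_sat (u := 1).
  have [n n1] := absorb_span lam 1; exists n => q /n1/span_val_exists[w <-].
  have [v <-] : exists v, phi v = w by exists (psi w); exact: psiK.
  exists (span_val v).
  by have := star_stableZ (-1) Jst (Je v); rewrite scaleN1r opprB.
exists t; apply/eqP; rewrite eq_sym -subr_eq0 -cycB; apply/eqP.
exact/cyc_left_mult.
Qed.

End SpanIsomorphism.

Theorem theorem6p3 (K : fieldType) (X : choiceType) (x0 : X)
    (gam lam : free_alg K X)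
    (gam_comonic : comonic gam) (gam_deg : (0 < degree gam)%N)
    (lam_comonic : comonic lam) (lam_deg : (0 < degree lam)%N) :
  [/\ irreducible lam <->
        simple_module (cyclic_module (leavitt_of lam)) /\
        simple_module (cofactor_module lam),
      forall pis : seq (free_alg K X),
        (forall p, p \in pis -> irreducible p) -> lam = \prod_(p <- pis) p ->
        has_length (cyclic_module (leavitt_of lam)) (size pis) /\
        has_length (cofactor_module lam) (size pis),
      forall pis rhos : seq (free_alg K X),
        (forall p, p \in pis -> irreducible p) -> lam = \prod_(p <- pis) p ->
        (forall p, p \in rhos -> irreducible p) -> lam = \prod_(p <- rhos) p ->
        size pis = size rhos
    & [/\ isomorphic (cofactor_module lam) (cofactor_module gam) <->
            isomorphic (cyclic_module gam) (cyclic_module lam),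
          isomorphic (cyclic_module gam) (cyclic_module lam) <->
            isomorphic (cyclic_module (leavitt_of gam))
                       (cyclic_module (leavitt_of lam))
        & similar_elements gam lam <->
            similar_elements (leavitt_of gam) (leavitt_of lam)]].
Proof.
have latM := saturated_lattice_leavitt lam_comonic.
have latV := saturated_lattice_span lam_comonic.
have lenM pis := has_length_factorization lam_comonic latM (pis := pis).
have cyclicE : isomorphic (cyclic_module gam) (cyclic_module lam) <->
    isomorphic (cyclic_module (leavitt_of gam)) (cyclic_module (leavitt_of lam)).
  rewrite !isomorphic_cyclicP; exact: similarity_leavitt.
split=> [|pis irr lamE|pis rhos irr lamE irr' lamE'|].
- split=> [irr|[simpleM _]]; last exact: simple_irreducible lam_comonic latM simpleM.
  split; first exact: irreducible_simple lam_comonic latM irr.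
  exact: irreducible_simple lam_comonic latV irr.
- by split; [exact: lenM | exact: has_length_factorization lam_comonic latV _ irr lamE].
- exact: has_length_unique (lenM _ irr lamE) (lenM _ irr' lamE').
split=> //; split=> [/isomorphic_sym/span_isomorphic_witness wit|].
  by apply/isomorphic_cyclicP; apply: wit.
case/isomorphic_cyclicP=> s wit; apply: isomorphic_sym.
exact: witness_span_isomorphic wit.
Qed.
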